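(* Let $\lambda_1,\ldots,\lambda_k$ be integers with $\gcd(\lambda_1,\ldots,\lambda_k)=1$. Then there exist a constant $\alpha>0$ and a function $g:\mathbb{N}\to[0,\infty)$ with $g(n)/n\to 0$ as $n\to\infty$ (both depending only on $\lambda_1,\ldots,\lambda_k$) such that for every sufficiently large prime $p$ and every $A\subset \mathbb{Z}/p\mathbb{Z}$ with $|A|\le \alpha p$, $$\big|\lambda_1A+\lambda_2A+\cdots+\lambda_kA\big|\;\ge\;\Big(\sum_{i=1}^k|\lambda_i|\Big)|A|-g(|A|).$$
   Context: For subsets $A,B$ of an abelian group, $A+B=\{a+b: a\in A,\ b\in B\}$, and for an integer $\lambda$, $\lambda A=\{\lambda a: a\in A\}$; iterated sums $\lambda_1A+\cdots+\lambda_kA$ are defined accordingly. *)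

(* Defs.v *)
From mathcomp Require Import all_boot all_order all_algebra.

Set Implicit Arguments.
Unset Strict Implicit.
Unset Printing Implicit Defensive.

Import GRing.Theory.

Local Open Scope ring_scope.

Section Sumsets.
Variable V : finZmodType.
Implicit Types A B : {set V}.

Definition sumset A B : {set V} := [set a + b | a in A, b in B].

Definition dilate (c : int) A : {set V} := [set a *~ c | a in A].

(* The empty sum (k = 0) is {0}, the neutral element of [sumset]. *)
Definition sum_dilates (k : nat) (lambda : 'I_k -> int) A : {set V} :=
  \big[sumset/[set 0]]_(i < k) dilate (lambda i) A.

End Sumsets.

(* Main.v *)
Require Import Defs.
From HB Require Import structures.
From mathcomp Require Import all_boot all_order all_algebra finmap.
From mathcomp Require Import all_classical all_reals all_analysis.
From mathcomp Require Import zify ring lra.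

Set Implicit Arguments.
Unset Strict Implicit.
Unset Printing Implicit Defensive.

Import Order.TTheory GRing.Theory Num.Theory.
Import numFieldNormedType.Exports.

Local Open Scope fset_scope.
Local Open Scope ring_scope.

(** If the sum S of the dilates has more than L |A| elements, L = sum |l_i|,
there is nothing to prove. Otherwise A has small doubling, so the iterated
sumsets of D = A - A grow polynomially (Petridis, Ruzsa covering).

In Z/pZ, polynomial growth and the moments of the Fourier transform force a
nonzero frequency at which the transform of A is arbitrarily close to |A|, so
half of a dilate of A lies in a very short arc; covering A by few translates of
that half and applying Dirichlet's theorem to the translations puts a dilate of
A into an arc short enough for all sums to be computed in Z.

In Z, take M a multiple of all the l_i, and refine the partition of A into
residue classes along a chain of moduli d_0, d_1, ... with M d_t | d_{t+1}, each
d_t being the gcd of the differences within classes. Levels at which a positive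
proportion of A lies in classes modulo d_t missing some subclass modulo M d_t
cost an exponential factor in the growth of the iterated sumsets of D, so at
some bounded level almost all classes meet all their subclasses. For such
classes the bound |sum l_i X_i| >= sum |l_i| |X_i| - O(1) follows by averaging,
and it is summed over classes by a layer-cake argument, using that the sum of
the dilates of a set C meets at least as many classes as C itself. *)

(** * Sumsets in abelian groups *)

Section FsetCardinals.
Variables T U : choiceType.
Implicit Types (A : {fset T}) (B : {fset U}).

Lemma leq_cardf_inj (f : T -> U) A B :
  {in A, forall x, f x \in B} -> {in A &, injective f} ->
  (#|` A| <= #|` B|)%N.
Proof.
move=> fAB finj; have -> : #|` A| = #|` f @` A| by rewrite card_in_imfset.
by apply: fsubset_leq_card; apply/fsubsetP => _ /imfsetP[x /= xA ->]; apply: fAB.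
Qed.

Lemma leq_cardf_surj (f : T -> U) A B :
  {in B, forall y, exists2 x, x \in A & y = f x} -> (#|` B| <= #|` A|)%N.
Proof.
move=> fAB; have le : (#|` [fset f x | x in A]| <= #|` A|)%N by apply: leq_imfset_card.
apply: leq_trans le; apply: fsubset_leq_card; apply/fsubsetP => y /fAB[x xA ->].
exact: in_imfset.
Qed.

Lemma cardfsM A B : #|` A `*` B| = (#|` A| * #|` B|)%N.
Proof.
rewrite -(size_allpairs pair (enum_fset A) (enum_fset B)).
set s := [seq _ | _ <- _, _ <- _]; have us : uniq s.
  by rewrite allpairs_uniq ?fset_uniq// => -[? ?] [? ?].
rewrite -(undup_id us) -card_fseq; congr (#|` _|); apply/fsetP => -[x y].
rewrite in_fsetM !inE /=; apply/andP/allpairsP => [[xA yB]|[[a b] /= [aA bB [-> ->]]]] //.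
by exists (x, y).
Qed.

Lemma exists_argminf (P : {fset T}) (r : T -> rat) : P != fset0 ->
  exists2 x, x \in P & forall z, z \in P -> r x <= r z.
Proof.
elim/fset1U_rect: P => [|x P xP IH _]; first by rewrite eqxx.
have [->|/IH[y yP ymin]] := eqVneq (P : {fset T}) fset0.
  by exists x; [rewrite !inE eqxx|move=> z; rewrite !inE orbF => /eqP ->].
have [le|/ltW le] := leP (r x) (r y).
  exists x; first exact: fset1U1.
  by move=> z /fset1UP[->//|/ymin]; apply: le_trans.
exists y; first exact: fset1Ur.
by move=> z /fset1UP[->//|/ymin].
Qed.

End FsetCardinals.

Section Sumsets.
Variable G : zmodType.
Implicit Types A B C D S U V W X Y Z : {fset G}.

(** Finite subsets of an arbitrary abelian group are used, so that the same results apply both in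
    [int] and in ['F_p]. *)
Definition addf A B : {fset G} := [fset a + b | a in A, b in B].
Definition oppf A : {fset G} := [fset - a | a in A].
Definition dilf (c : int) A : {fset G} := [fset a *~ c | a in A].
Definition nsumf n A : {fset G} := iter n (addf A) [fset 0].

Lemma addfP A B x :
  reflect (exists2 a, a \in A & exists2 b, b \in B & x = a + b)
          (x \in addf A B).
Proof. exact: imfset2P. Qed.

Lemma mem_addf A B a b : a \in A -> b \in B -> a + b \in addf A B.
Proof. by move=> aA bB; apply/addfP; exists a => //; exists b. Qed.

Lemma mem_oppf A a : (a \in oppf A) = (- a \in A).
Proof.
apply/imfsetP/idP => [[b /= bA ->]|aA]; first by rewrite opprK.
by exists (- a); rewrite //= opprK.
Qed.

Lemma dilfP c A x : reflect (exists2 a, a \in A & x = a *~ c) (x \in dilf c A).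
Proof. exact: imfsetP. Qed.

Lemma mem_dilf c A a : a \in A -> a *~ c \in dilf c A.
Proof. by move=> aA; apply/dilfP; exists a. Qed.

Lemma addfC : commutative addf.
Proof.
by move=> A B; apply/fsetP => x; apply/addfP/addfP => -[a aA [b bB ->]];
  exists b => //; exists a => //; rewrite addrC.
Qed.

Lemma addfA : associative addf.
Proof.
move=> A B C; apply/fsetP => x; apply/addfP/addfP.
  move=> [a aA [_ /addfP[b bB [c cC ->]] ->]].
  by exists (a + b); [apply: mem_addf|exists c => //; rewrite addrA].
move=> [_ /addfP[a aA [b bB ->]] [c cC ->]].
by exists a => //; exists (b + c); [apply: mem_addf|rewrite addrA].
Qed.

Lemma add0f : left_id [fset 0] addf.
Proof.
move=> A; apply/fsetP => x; apply/addfP/idP => [[a]|xA].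
  by rewrite inE => /eqP -> [b bB ->]; rewrite add0r.
by exists 0; [rewrite inE|exists x => //; rewrite add0r].
Qed.

Lemma addfACA : interchange addf addf.
Proof.
move=> A B C D; rewrite -!addfA; congr addf.
by rewrite !addfA (addfC B).
Qed.

HB.instance Definition _ :=
  Monoid.isComLaw.Build {fset G} [fset 0] addf addfA addfC add0f.

Lemma addfS A B A' B' : A `<=` A' -> B `<=` B' -> addf A B `<=` addf A' B'.
Proof.
move=> /fsubsetP sA /fsubsetP sB; apply/fsubsetP => _ /addfP[a aA [b bB ->]].
by apply: mem_addf; [apply: sA|apply: sB].
Qed.

Lemma oppfK : involutive oppf.
Proof. by move=> A; apply/fsetP => x; rewrite !mem_oppf opprK. Qed.

Lemma oppfD A B : oppf (addf A B) = addf (oppf A) (oppf B).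
Proof.
apply/fsetP => x; rewrite mem_oppf; apply/addfP/addfP => -[a aA [b bB e]].
  exists (- a); first by rewrite mem_oppf opprK.
  by exists (- b); rewrite ?mem_oppf ?opprK// -opprD -e opprK.
exists (- a); first by rewrite -mem_oppf.
by exists (- b); rewrite -?mem_oppf// e opprD.
Qed.

Lemma card_oppf A : #|` oppf A| = #|` A|.
Proof. by rewrite card_imfset //; apply: oppr_inj. Qed.

Lemma card_dilf_inj c A :
  injective (fun x : G => x *~ c) -> #|` dilf c A| = #|` A|.
Proof. by move=> cinj; rewrite card_imfset. Qed.

Lemma card_addf_le A B : (#|` addf A B| <= #|` A| * #|` B|)%N.
Proof.
rewrite -cardfsM; apply: (leq_cardf_surj (f := fun u => u.1 + u.2)).
move=> _ /addfP[a aA [b bB ->]]; exists (a, b) => //.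
by rewrite in_fsetM /= aA.
Qed.

Lemma card_addf_ger A B : A != fset0 -> (#|` B| <= #|` addf A B|)%N.
Proof.
move=> /fset0Pn[a aA]; apply: (leq_cardf_inj (f := fun b => a + b)).
  by move=> b bB; apply: mem_addf.
by move=> x y _ _; apply: addrI.
Qed.

Lemma card_addf_gel A B : B != fset0 -> (#|` A| <= #|` addf A B|)%N.
Proof. by rewrite addfC; apply: card_addf_ger. Qed.

Lemma addf_neq0 A B : A != fset0 -> B != fset0 -> addf A B != fset0.
Proof.
move=> /fset0Pn[a aA] /fset0Pn[b bB]; apply/fset0Pn; exists (a + b).
exact: mem_addf.
Qed.

Lemma nsumfD m n A : nsumf (m + n) A = addf (nsumf m A) (nsumf n A).
Proof.
elim: m => [|m IH]; first by rewrite add0f.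
by rewrite addSn [LHS]iterS [nsumf m.+1 A]iterS -addfA -IH.
Qed.

Lemma nsumf1 A : nsumf 1 A = A.
Proof. by rewrite /nsumf /= addfC add0f. Qed.

Lemma mem0_nsumf n A : 0 \in A -> 0 \in nsumf n A.
Proof.
move=> A0; elim: n => [|n IH]; first by rewrite inE.
by rewrite -(addr0 0); apply: mem_addf.
Qed.

Lemma nsumf_leq m n A : 0 \in A -> (m <= n)%N -> nsumf m A `<=` nsumf n A.
Proof.
move=> A0 /subnK <-; rewrite nsumfD; apply/fsubsetP => x xm.
by rewrite -(add0r x); apply: mem_addf => //; apply: mem0_nsumf.
Qed.

(** Ruzsa's triangle inequality. Fix a representation x = u - v of each x in U - V: the sum of u - w
    and w - v returns x, hence u, hence w. *)
Lemma ruzsa_triangle U V W :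
  (#|` W| * #|` addf U (oppf V)|
     <= #|` addf U (oppf W)| * #|` addf W (oppf V)|)%N.
Proof.
pose D := addf U (oppf V).
have /choice[f fP] : forall x, exists uv : G * G,
    x \in D -> [/\ uv.1 \in U, uv.2 \in V & x = uv.1 - uv.2].
  move=> x; case: (boolP (x \in D)) => [/addfP[u uU [v vV ->]]|xD].
    by exists (u, - v) => _; rewrite -mem_oppf /= opprK.
  by exists (0, 0).
rewrite -!cardfsM.
apply: (leq_cardf_inj (f := fun u => ((f u.2).1 - u.1, u.1 - (f u.2).2))).
  move=> [w x]; rewrite in_fsetM /= => /andP[wW /fP[uU vV _]].
  by rewrite in_fsetM /= !mem_addf // mem_oppf opprK.
move=> [w x] [w' x']; rewrite !in_fsetM /= => /andP[wW xD] /andP[wW' xD'] [e1 e2].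
have [_ _ ex] := fP _ xD; have [_ _ ex'] := fP _ xD'.
have exx : x = x'.
  by rewrite ex ex' -(subrKA w) e1 e2 subrKA.
by move: e1; rewrite exx => /addrI /oppr_inj ->.
Qed.

(** Ruzsa's covering lemma: S is chosen greedily so that the translates s + B stay disjoint. *)
Lemma ruzsa_covering Y B : B != fset0 ->
  exists S, [/\ S `<=` Y, (#|` S| * #|` B| <= #|` addf Y B|)%N &
    Y `<=` addf S (addf B (oppf B))].
Proof.
move=> B0.
suff [S [sSY cS sY]] : exists S, [/\ S `<=` Y,
    #|` addf S B| = (#|` S| * #|` B|)%N & Y `<=` addf S (addf B (oppf B))].
  exists S; split => //; rewrite -cS; apply: fsubset_leq_card.
  exact: addfS.
elim/fset1U_rect: Y => [|y Y yY [S [sSY cS sY]]].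
  exists fset0; split; rewrite ?fsub0set // cardfs0 mul0n; apply/eqP.
  by rewrite cardfs_eq0; apply/eqP/fsetP => x; apply/addfP => -[? ].
(* If y + B meets S + B, then y already lies in S + B - B and S is kept; otherwise y joins S. *)
have [/fset0Pn[z]|] := boolP (addf [fset y] B `&` addf S B != fset0).
  rewrite inE => /andP[/addfP[y' /fset1P -> [b bB ->]] /addfP[s sS [b' bB' e]]].
  exists S; split => //.
    by apply: fsubset_trans sSY (fsubsetUr _ _).
  rewrite fsubUset sY andbT fsub1set.
  have -> : y = s + (b' - b) by rewrite addrA -e addrK.
  by rewrite !mem_addf // mem_oppf opprK.
rewrite negbK => /eqP dis; exists (y |` S); split.
- exact: fsetUS.
- have -> : addf (y |` S) B = addf [fset y] B `|` addf S B.
    apply/fsetP => x; rewrite inE; apply/addfP/orP.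
      move=> [a /fset1UP[->|aS] [b bB ->]]; [left|right]; apply: mem_addf => //.
      by rewrite inE.
    move=> [] /addfP[a aS [b bB ->]]; exists a; last by exists b.
    + by rewrite inE aS.
    + by exists b.
    + by rewrite !inE aS orbT.
  rewrite cardfsU dis cardfs0 subn0 cS cardfsU1.
  have -> : #|` addf [fset y] B| = #|` B|.
    apply/eqP; rewrite eqn_leq card_addf_ger ?andbT; last first.
      by apply/fset0Pn; exists y; rewrite inE.
    by apply: (leq_trans (card_addf_le _ _)); rewrite cardfs1 mul1n.
  have yS : y \notin S by apply: contra yY => /(fsubsetP sSY).
  by rewrite yS mulnDl mul1n.
- rewrite fsubUset; apply/andP; split.
    have /fset0Pn[b bB] := B0.
    rewrite fsub1set; apply/addfP; exists y; first exact: fset1U1.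
    by exists (b - b); rewrite ?subrr ?addr0 // -(subrr b) mem_addf // mem_oppf opprK.
  apply: fsubset_trans sY _; apply: addfS => //.
  exact: fsubsetUr.
Qed.

(** Petridis's inequality, proved by adding the elements of C one at a time. *)
Lemma petridis X B : X != fset0 ->
  (forall Z, Z `<=` X -> (#|` addf X B| * #|` Z| <= #|` addf Z B| * #|` X|)%N) ->
  forall C, (#|` addf (addf X B) C| * #|` X| <= #|` addf X B| * #|` addf X C|)%N.
Proof.
move=> X0 Xmin; elim/fset1U_rect => [|c C cC IH].
  have -> : addf (addf X B) fset0 = fset0.
    by apply/fsetP => x; apply/addfP => -[? _ []].
  by rewrite cardfs0.
(* Adding c creates at most |X + B| - |Z + B| new elements of X + B + C and at least |X| - |W| new
   elements of X + C. As W is contained in Z, minimality of X applied to Z balances the two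
   gains. *)
pose Z := [fset x in X | addf [fset x + c] B `<=` addf (addf X B) C].
pose W := [fset x in X | x + c \in addf X C].
have sZX : Z `<=` X by apply/fsubsetP => x; rewrite !inE => /andP[].
have sWX : W `<=` X by apply/fsubsetP => x; rewrite !inE => /andP[].
have sWZ : W `<=` Z.
  apply/fsubsetP => x; rewrite !inE /= => /andP[-> /addfP[x' xX' [c' cC' e]]] /=.
  apply/fsubsetP => _ /addfP[_ /fset1P-> [b bB ->]].
  by rewrite e addrAC !mem_addf.
have e1 : addf (addf X B) (c |` C) `<=`
    addf (addf X B) C `|` (addf [fset c] (addf X B) `\` addf [fset c] (addf Z B)).
  apply/fsubsetP => _ /addfP[_ /addfP[x xX [b bB ->]] [c' /fset1UP[->|cC'] ->]];
    rewrite in_fsetU; last by rewrite !mem_addf.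
  have [//|nin /=] := boolP (_ \in addf (addf X B) C).
  rewrite in_fsetD; apply/andP; split; last first.
    by rewrite addrC !mem_addf // inE.
  apply/negP => /addfP[_ /fset1P-> [_ /addfP[z zZ [b' bB' ->]] e]].
  move: zZ; rewrite !inE /= => /andP[_ /fsubsetP sz].
  case/negP: nin; rewrite e addrA (addrC c); apply: sz.
  by apply: mem_addf => //; rewrite inE.
have e2 : addf X C `|` (addf [fset c] (X `\` W)) `<=` addf X (c |` C).
  rewrite fsubUset addfS ?fsubsetUr //=.
  apply/fsubsetP => y /addfP[c' /fset1P -> [x]].
  rewrite in_fsetD => /andP[_ xX] ->; rewrite addrC mem_addf //.
  exact: fset1U1.
have cardc Y : #|` addf [fset c] Y| = #|` Y|.
  apply/eqP; rewrite eqn_leq card_addf_ger ?andbT; last first.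
    by apply/fset0Pn; exists c; rewrite inE.
  by apply: (leq_trans (card_addf_le _ _)); rewrite cardfs1 mul1n.
have h1 : (#|` addf (addf X B) (c |` C)|
   <= #|` addf (addf X B) C| + (#|` addf X B| - #|` addf Z B|))%N.
  apply: (leq_trans (fsubset_leq_card e1)); rewrite cardfsU.
  apply: (leq_trans (leq_subr _ _)); rewrite cardfsDS ?cardc //.
  by apply: addfS => //; apply: addfS.
have h2 : (#|` addf X C| + (#|` X| - #|` W|) <= #|` addf X (c |` C)|)%N.
  apply: leq_trans (fsubset_leq_card e2); rewrite cardfsU cardc cardfsDS //.
  suff -> : addf X C `&` addf [fset c] (X `\` W) = fset0 by rewrite cardfs0 subn0.
  apply/fsetP => y; rewrite !inE; apply/andP => -[yC].
  move=> /addfP[_ /fset1P -> [x]]; rewrite in_fsetD => /andP[xW xX] e.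
  by case/negP: xW; rewrite !inE /= xX addrC -e.
have h3 : (#|` addf Z B| <= #|` addf X B|)%N by apply/fsubset_leq_card/addfS.
have h4 := fsubset_leq_card sZX; have h5 := fsubset_leq_card sWZ.
have h6 := Xmin _ sZX.
nia.
Qed.

(** X minimises |X + B| / |X| among the nonempty subsets of A; the last clause compares it with A
    itself. *)
Lemma exists_min_ratio A B : A != fset0 ->
  exists X, [/\ X != fset0, X `<=` A, forall Z, Z `<=` X ->
    (#|` addf X B| * #|` Z| <= #|` addf Z B| * #|` X|)%N &
    (#|` addf X B| * #|` A| <= #|` addf A B| * #|` X|)%N].
Proof.
move=> A0.
pose P := [fset X in fpowerset A | X != fset0].
have PP X : (X \in P) = (X `<=` A) && (X != fset0).
  by rewrite !inE /= fpowersetE.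
pose r X : rat := #|` addf X B|%:R / #|` X|%:R.
have [X XP Xmin] : exists2 X, X \in P & forall Z, Z \in P -> r X <= r Z.
  apply: exists_argminf; apply/fset0Pn; exists A.
  by rewrite PP fsubset_refl.
move: XP; rewrite PP => /andP[sXA X0].
have key Z : Z `<=` A -> (#|` addf X B| * #|` Z| <= #|` addf Z B| * #|` X|)%N.
  have [->|Z0 sZA] := eqVneq Z fset0; first by rewrite cardfs0 muln0.
  have := Xmin Z; rewrite PP sZA Z0 => /(_ isT); rewrite /r.
  rewrite ler_pdivrMr ?ltr0n ?cardfs_gt0// mulrAC ler_pdivlMr ?ltr0n ?cardfs_gt0//.
  by rewrite -!natrM ler_nat.
exists X; split => // [Z sZX|]; apply: key => //.
exact: fsubset_trans sZX sXA.
Qed.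

(** Plünnecke's inequality. The minimising set does not depend on n: Petridis's inequality with C =
    nB costs one factor K per added summand. *)
Lemma plunnecke A B K : A != fset0 -> (#|` addf A B| <= K * #|` A|)%N ->
  exists X, [/\ X != fset0, X `<=` A &
    forall n, (#|` addf X (nsumf n B)| <= K ^ n * #|` X|)%N].
Proof.
move=> A0 hK; have [X [X0 sXA Xmin XA]] := exists_min_ratio B A0.
have XK : (#|` addf X B| <= K * #|` X|)%N.
  have : (0 < #|` A|)%N by rewrite cardfs_gt0.
  nia.
exists X; split => //; elim => [|n IH].
  by rewrite addfC add0f expn0 mul1n.
rewrite [nsumf _ _]/= addfA.
have := petridis X0 Xmin (nsumf n B).
have : (0 < #|` X|)%N by rewrite cardfs_gt0.
by rewrite expnS; nia.
Qed.

(* The elements of the n-fold sumset of S are the combinations of the elements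
   of S with coefficients at most n. *)
Lemma card_nsumf_le n S : (#|` nsumf n S| <= n.+1 ^ #|` S|)%N.
Proof.
pose F := [fset f in {: {ffun S -> 'I_n.+1}}].
have -> : (n.+1 ^ #|` S|)%N = #|` F|.
  by rewrite card_finset card_ffun card_ord cardfE.
apply: (leq_cardf_surj (f := fun f : {ffun S -> 'I_n.+1} => \sum_s val s *+ f s)).
suff : forall m x, (m <= n)%N -> x \in nsumf m S -> exists f : S -> nat,
    (forall s, (f s <= m)%N) /\ x = \sum_s val s *+ f s.
  move=> H x /(H _ _ (leqnn n))[f [fn ->]].
  exists [ffun s => inord (f s)]; first by rewrite !inE.
  by apply: eq_bigr => s _; rewrite ffunE inordK // ltnS.
elim => [|m IH] x mn.
  rewrite inE => /eqP ->; exists (fun=> 0%N); split => //.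
  by rewrite big1.
move=> /addfP[s sS [y /(IH _ (ltnW mn))[f [fm ->]] ->]].
exists (fun t => (t == [` sS]) + f t)%N; split.
  by move=> t; case: eqP => _; rewrite ?add1n ?ltnS // add0n (leq_trans (fm t)).
under [RHS]eq_bigr => t _ do rewrite mulrnDr.
rewrite big_split /=; congr (_ + _).
rewrite (bigD1 [` sS]) //= eqxx big1 ?addr0 // => t /negPf ->.
by rewrite mulr0n.
Qed.

(** With D = A - A, covering gives 2D inside S + D with |S| at most K^5. Hence (n+1)D lies in nS +
    D, and nS grows polynomially because S has bounded size. *)
Lemma polynomial_growth A K : A != fset0 ->
  (#|` addf A (oppf A)| <= K * #|` A|)%N ->
  forall n, (#|` nsumf n.+1 (addf A (oppf A))| <= n.+1 ^ (K ^ 5) * (K * #|` A|))%N.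
Proof.
move=> A0 hK n; set D := addf A (oppf A).
have [X [X0 sXA Xn]] := plunnecke A0 hK.
have X_gt0 : (0 < #|` X|)%N by rewrite cardfs_gt0.
have oppn m : oppf (nsumf m A) = nsumf m (oppf A).
  elim: m => [|m IH]; last by rewrite /= oppfD IH.
  by apply/fsetP => x; rewrite mem_oppf !inE oppr_eq0.
(* 2D + A equals 2(-A) - 3(-A); the triangle inequality through -X meets the Plünnecke bounds K^2
   and K^3. *)
have h : (#|` addf (nsumf 2 D) A| <= K ^ 5 * #|` A|)%N.
  have -> : addf (nsumf 2 D) A = addf (nsumf 2 (oppf A)) (oppf (nsumf 3 (oppf A))).
    rewrite -(oppn 3) oppfK /nsumf /= !(addfC _ [fset 0]) !add0f /D.
    rewrite (addfACA A) (addfC (addf A A)) -addfA; congr addf.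
    by rewrite addfA.
  have := ruzsa_triangle (nsumf 2 (oppf A)) (nsumf 3 (oppf A)) (oppf X).
  rewrite card_oppf oppfK -oppfD card_oppf (addfC _ X).
  move=> tri; rewrite -(leq_pmul2l X_gt0); apply: (leq_trans tri).
  apply: (leq_trans (leq_mul (Xn 2%N) (Xn 3%N))).
  have -> : (K ^ 2 * #|` X| * (K ^ 3 * #|` X|) = #|` X| * (K ^ 5 * #|` X|))%N.
    by rewrite (expnD K 2 3); ring.
  by rewrite !leq_mul2l fsubset_leq_card ?orbT.
have [S [sS cS cov]] := ruzsa_covering (nsumf 2 D) A0.
have A_gt0 : (0 < #|` A|)%N by rewrite cardfs_gt0.
have cS5 : (#|` S| <= K ^ 5)%N.
  by rewrite -(leq_pmul2r A_gt0); apply: leq_trans cS h.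
have inc : nsumf n.+1 D `<=` addf (nsumf n S) D.
  elim: n => [|n IH]; first by rewrite nsumf1 add0f.
  apply: (@fsubset_trans _ (addf D (addf (nsumf n S) D))).
    by rewrite [nsumf n.+2 D]/=; apply: addfS.
  have -> : nsumf n.+1 S = addf (nsumf n S) S by rewrite -addn1 nsumfD nsumf1.
  rewrite addfC -!addfA; apply: addfS => //.
  by apply: fsubset_trans cov; rewrite addfA /nsumf /= (addfC D [fset 0]) add0f.
apply: (leq_trans (fsubset_leq_card inc)).
apply: (leq_trans (card_addf_le _ _)); apply: leq_mul => //.
apply: (leq_trans (card_nsumf_le _ _)).
by rewrite leq_pexp2l.
Qed.

End Sumsets.

(** * Counting by fibres *)

Lemma cardf_sumE (T : choiceType) (A : {fset T}) (P : pred T) :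
  #|` [fset x in A | P x]| = (\sum_(x <- A) P x)%N.
Proof.
rewrite card_fset_sum1 -big_fset_condE big_mkcond /=.
by apply: eq_bigr => x _; case: (P x).
Qed.

Lemma sum_pred1 (T : choiceType) (Z : {fset T}) u :
  (\sum_(z <- Z) (u == z) = (u \in Z))%N.
Proof.
have -> : (u \in Z) = #|` [fset z in Z | u == z]| :> nat.
  case: (boolP (u \in Z)) => uZ.
    have -> : [fset z in Z | u == z] = [fset u].
      apply/fsetP => z; rewrite !inE eq_sym /=.
      by have [->|] := eqVneq z u; rewrite ?uZ ?andbF.
    by rewrite cardfs1.
  apply/esym/eqP; rewrite cardfs_eq0; apply/eqP/fsetP => z; rewrite !inE /=.
  by apply/negP => /andP[zZ /eqP e]; rewrite e zZ in uZ.
by rewrite cardf_sumE.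
Qed.

Section FiberCounting.
Variables T U : choiceType.
Implicit Types (A : {fset T}) (Z : {fset U}).

Lemma sum_card_fibers (h : T -> U) A Z :
  (\sum_(z <- Z) #|` [fset x in A | h x == z]| = \sum_(x <- A) (h x \in Z))%N.
Proof.
under eq_bigr => z _ do rewrite cardf_sumE.
by rewrite exchange_big /=; apply: eq_bigr => x _; rewrite sum_pred1.
Qed.

Lemma sum_card_fibers_eq (h : T -> U) A Z : {in A, forall x, h x \in Z} ->
  (\sum_(z <- Z) #|` [fset x in A | h x == z]| = #|` A|)%N.
Proof.
move=> hA; rewrite sum_card_fibers card_fset_sum1 big_seq [RHS]big_seq.
by apply: eq_bigr => x /hA ->.
Qed.

Lemma sum_card_fibers_le (h : T -> U) A Z :
  (\sum_(z <- Z) #|` [fset x in A | h x == z]| <= #|` A|)%N.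
Proof.
by rewrite sum_card_fibers card_fset_sum1; apply: leq_sum => x _; case: (_ \in _).
Qed.

Lemma sum_card_disjoint (J : finType) (F : J -> {fset T}) A :
  (forall j, F j `<=` A) ->
  (forall x i j, x \in F i -> x \in F j -> i = j) ->
  (\sum_j #|` F j| <= #|` A|)%N.
Proof.
move=> sF dF.
have cF j : #|` F j| = (\sum_(x <- A) (x \in F j))%N.
  rewrite -cardf_sumE; congr (#|` _|); apply/fsetP => x; rewrite !inE /=.
  by apply/idP/andP => [xF|[]//]; split=> //; apply: (fsubsetP (sF j)).
under eq_bigr => j _ do rewrite cF.
rewrite exchange_big /= card_fset_sum1; apply: leq_sum => x _.
case: (pickP (fun j => x \in F j)) => [j xj|nj]; last first.
  by rewrite big1 // => j _; rewrite nj.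
rewrite (bigD1 j) //= big1 ?addn0 ?leq_b1 // => i ij.
case: (boolP (x \in F i)) => // xi; by rewrite (dF _ _ _ xi xj) eqxx in ij.
Qed.

End FiberCounting.

(** * Sums of dilates *)

Section SumsOfDilates.
Variables (G : zmodType) (I : eqType).
Implicit Types (r : seq I) (l : I -> int) (X Y : I -> {fset G}) (A : {fset G}).

(** Each summand carries its own set, because residue classes chosen separately for each coefficient
    get added; the list [r] allows induction and the removal of zero coefficients. *)
Definition sumdil r l X : {fset G} :=
  \big[@addf G/[fset 0]]_(i <- r) dilf (l i) (X i).

Lemma sumdil_cons i r l X :
  sumdil (i :: r) l X = addf (dilf (l i) (X i)) (sumdil r l X).
Proof. exact: big_cons. Qed.

Lemma sumdilP r l X x : uniq r ->
  reflect (exists2 a : I -> G, {in r, forall i, a i \in X i} &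
             x = \sum_(i <- r) a i *~ l i)
          (x \in sumdil r l X).
Proof.
elim: r x => [|i r IH] x.
  move=> _; rewrite /sumdil big_nil inE.
  apply: (iffP eqP) => [->|[a _ ->]]; last by rewrite big_nil.
  by exists (fun=> 0) => //; rewrite big_nil.
rewrite sumdil_cons /= => /andP[ir ur]; apply: (iffP (addfP _ _ _)).
  move=> [_ /dilfP[b bX ->] [_ /(IH _ ur)[a aX ->] ->]].
  exists (fun j => if j == i then b else a j).
    move=> j; rewrite inE; case: eqVneq => [-> //|_ /=]; exact: aX.
  rewrite big_cons eqxx; congr (_ + _).
  by apply: eq_big_seq => j jr; case: eqVneq ir => // <-; rewrite jr.
move=> [a aX ->]; rewrite big_cons; exists (a i *~ l i).
  by apply: mem_dilf; apply: aX; rewrite mem_head.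
exists (\sum_(j <- r) a j *~ l j) => //; apply/(IH _ ur).
by exists a => // j jr; apply: aX; rewrite inE jr orbT.
Qed.

Lemma sumdilS r l X Y : {in r, forall i, X i `<=` Y i} ->
  sumdil r l X `<=` sumdil r l Y.
Proof.
elim: r => [|i r IH] sXY; first by rewrite /sumdil !big_nil.
rewrite !sumdil_cons; apply: addfS; last first.
  by apply: IH => j jr; apply: sXY; rewrite inE jr orbT.
apply/fsubsetP => _ /dilfP[a aX ->]; apply: mem_dilf.
by apply: (fsubsetP (sXY i _)) => //; rewrite mem_head.
Qed.

Lemma sumdil_neq0 r l X : {in r, forall i, X i != fset0} -> sumdil r l X != fset0.
Proof.
elim: r => [|i r IH] X0.
  by rewrite /sumdil big_nil; apply/fset0Pn; exists 0; rewrite inE.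
rewrite sumdil_cons; apply: addf_neq0; last first.
  by apply: IH => j jr; apply: X0; rewrite inE jr orbT.
have /fset0Pn[a aX] : X i != fset0 by apply: X0; rewrite mem_head.
by apply/fset0Pn; exists (a *~ l i); apply: mem_dilf.
Qed.

Lemma card_sumdil_le r l A :
  (#|` sumdil r l (fun=> A)| <= #|` A| ^ size r)%N.
Proof.
elim: r => [|i r IH]; first by rewrite /sumdil big_nil cardfs1.
rewrite sumdil_cons expnS; apply: (leq_trans (card_addf_le _ _)).
by apply: leq_mul => //; apply: leq_imfset_card.
Qed.

(** Two dilates suffice: the triangle inequality through -(l_j A) bounds |A| |l_i (A - A)| by |l_i A
    + l_j A|^2, and the other summands can only enlarge the sum. *)
Lemma small_difference_set r l A L : (1 < size r)%N -> A != fset0 ->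
  {in r, forall i, injective (fun x : G => x *~ l i)} ->
  (#|` sumdil r l (fun=> A)| <= L * #|` A|)%N ->
  (#|` addf A (oppf A)| <= L ^ 2 * #|` A|)%N.
Proof.
case: r => [|i [|j r]] // _ A0 linj hL.
have li : injective (fun x : G => x *~ l i) by apply: linj; rewrite mem_head.
have lj : injective (fun x : G => x *~ l j) by apply: linj; rewrite !inE eqxx orbT.
have le : (#|` addf (dilf (l i) A) (dilf (l j) A)| <= L * #|` A|)%N.
  apply: leq_trans hL; rewrite !sumdil_cons addfA; apply: card_addf_gel.
  exact: sumdil_neq0.
have := ruzsa_triangle (dilf (l i) A) (dilf (l i) A) (oppf (dilf (l j) A)).
rewrite oppfK card_oppf -oppfD card_oppf (addfC (dilf (l j) A)) card_dilf_inj //.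
have -> : addf (dilf (l i) A) (oppf (dilf (l i) A)) = dilf (l i) (addf A (oppf A)).
  apply/fsetP => x; apply/addfP/dilfP.
    move=> [_ /dilfP[a aA ->] [b]]; rewrite mem_oppf => /dilfP[a' aA' e] ->.
    exists (a - a'); first by rewrite mem_addf // mem_oppf opprK.
    by rewrite mulrzBl -e opprK.
  move=> [_ /addfP[a aA [b]] + -> ->]; rewrite mem_oppf => bA.
  exists (a *~ l i); first exact: mem_dilf.
  exists (b *~ l i); last by rewrite mulrzDl.
  by rewrite mem_oppf -mulNrz mem_dilf.
rewrite card_dilf_inj // => tri.
have A_gt0 : (0 < #|` A|)%N by rewrite cardfs_gt0.
rewrite -(leq_pmul2l A_gt0); apply: (leq_trans tri).
apply: (leq_trans (leq_mul le le)).
by rewrite leq_eqVlt; apply/orP; left; apply/eqP; ring.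
Qed.

End SumsOfDilates.

(** * Integer sets meeting all residue classes *)

Section IntegerSumsets.
Implicit Types A B C : {fset int}.

(** The sets A + min B and max A + B share only the point max A + min B. *)
Lemma card_addf_int A B : A != fset0 -> B != fset0 ->
  (#|` A| + #|` B| <= #|` addf A B|.+1)%N.
Proof.
move=> A0 B0.
have [a aA amax] := exists_argminf (fun x : int => - (x%:~R : rat)) A0.
have [b bB bmin] := exists_argminf (fun x : int => x%:~R : rat) B0.
have {}amax x : x \in A -> x <= a by move=> /amax; rewrite lerN2 ler_int.
have {}bmin x : x \in B -> b <= x by move=> /bmin; rewrite ler_int.
pose U := [fset x + b | x in A]; pose V := [fset a + y | y in B].
have cU : #|` U| = #|` A| by rewrite card_imfset //; apply: addIr.
have cV : #|` V| = #|` B| by rewrite card_imfset //; apply: addrI.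
have sUV : U `|` V `<=` addf A B.
  rewrite fsubUset; apply/andP; split; apply/fsubsetP => _ /imfsetP[x /= xA ->];
  exact: mem_addf.
have cI : (#|` U `&` V| <= 1)%N.
  rewrite -(cardfs1 (a + b)); apply: fsubset_leq_card; apply/fsubsetP => z.
  rewrite in_fsetI => /andP[/imfsetP[x /= xA ->] /imfsetP[y /= yB e]].
  have := amax _ xA; have := bmin _ yB; rewrite inE => ? ?.
  by apply/eqP; lia.
have := cardfsUI U V; rewrite cU cV => eUV.
have le := fsubset_leq_card sUV.
by rewrite -eUV -addn1 leq_add.
Qed.

Lemma mulrz_int_inj (c : int) : c != 0 -> injective (fun x : int => x *~ c).
Proof. by move=> c0 x y /=; rewrite !mulrzz => /(mulIf c0). Qed.

Variable I : eqType.
Implicit Types (r : seq I) (l c u : I -> int) (X : I -> {fset int}).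

Lemma card_sumdil_int r l X : {in r, forall i, l i != 0} ->
  {in r, forall i, X i != fset0} ->
  (\sum_(i <- r) #|` X i| <= #|` sumdil r l X| + size r)%N.
Proof.
elim: r => [|i r IH] l0 X0; first by rewrite big_nil.
have X0' : {in r, forall j, X j != fset0}.
  by move=> j jr; apply: X0; rewrite inE jr orbT.
have := IH _ X0' => /(_ _)/wrap[|IH'].
  by move=> j jr; apply: l0; rewrite inE jr orbT.
have li : l i != 0 by apply: l0; rewrite mem_head.
have := @card_addf_int (dilf (l i) (X i)) (sumdil r l X).
rewrite card_dilf_inj; last exact: mulrz_int_inj.
rewrite -cardfs_gt0 card_dilf_inj; last exact: mulrz_int_inj.
rewrite cardfs_gt0 X0 ?mem_head // => /(_ isT (sumdil_neq0 _ X0')).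
move=> h; rewrite big_cons sumdil_cons /= addnS -addSn.
by apply: leq_trans (leq_add h (leqnn _)); rewrite -addnA leq_add2l.
Qed.

Lemma sumdil_congr r l X c (d : int) : {in r, forall i, {in X i, forall x,
    (d %| x - c i)%Z}} ->
  {in sumdil r l X, forall x, (d %| x - \sum_(i <- r) c i * l i)%Z}.
Proof.
elim: r => [|i r IH] H x.
  by rewrite /sumdil !big_nil inE => /eqP ->; rewrite subrr dvdz0.
rewrite sumdil_cons => /addfP[_ /dilfP[a aX ->] [b bX ->]].
rewrite big_cons mulrzz.
have -> : a * l i + b - (c i * l i + \sum_(j <- r) c j * l j)
  = (a - c i) * l i + (b - \sum_(j <- r) c j * l j) by ring.
apply: rpredD; first by apply/dvdz_mulr/H => //; rewrite mem_head.
by apply: IH => // j jr; apply: H; rewrite inE jr orbT.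
Qed.

Lemma bezout_seq r l : uniq r -> exists u,
  \sum_(i <- r) l i * u i = \big[gcdz/0]_(i <- r) l i.
Proof.
elim: r => [|i r IH] /=; first by exists (fun=> 0); rewrite !big_nil.
move=> /andP[ir /IH[u eu]].
have [a [b e]] := Bezoutz (l i) (\big[gcdz/0]_(j <- r) l j).
exists (fun j => if j == i then a else b * u j).
rewrite !big_cons eqxx -e mulrC; congr (_ + _).
rewrite -eu mulr_sumr; apply: eq_big_seq => j jr.
by case: eqVneq ir => [<-|_ _]; rewrite ?jr //; ring.
Qed.

Lemma count_congruent (q k : nat) (e : int) : (0 < q)%N ->
  (k <= \sum_(0 <= rho < k * q) (q%:Z %| (e - rho%:Z)%R)%Z)%N.
Proof.
move=> q0; elim: k => [|k IH] //.
rewrite (big_cat_nat (n := (k * q)%N)) //=; last by rewrite leq_mul2r leqnSn orbT.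
rewrite -addn1; apply: leq_add => //.
have m0 : (0 <= (e %% q)%Z)%R by apply: modz_ge0; lia.
have mq : ((e %% q)%Z < q%:Z)%R by apply: ltz_pmod; lia.
pose w := (k * q + `|(e %% q)%Z|)%N.
rewrite (bigD1_seq w) /= ?iota_uniq //; last first.
  by rewrite mem_index_iota /w; apply/andP; split; nia.
suff -> : (q%:Z %| e - w%:Z)%Z by [].
apply/dvdzP; exists ((e %/ q)%Z - k%:Z).
rewrite {1}(divz_eq e q) /w PoszD gez0_abs // PoszM; ring.
Qed.

(* Averaging argument: the subsums over the classes rho + s u_i modulo
   m / |l_i|, for s < m, lie in distinct classes modulo d m because
   sum l_i u_i = 1; for random rho each class has average size
   |l_i| |X_i| / m. *)
Lemma card_sumdil_full_classes r l u c X (d : int) (m : nat) :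
  uniq r -> 0 < d -> (0 < m)%N ->
  {in r, forall i, l i != 0} -> {in r, forall i, (`|l i| %| m)%N} ->
  \sum_(i <- r) l i * u i = 1 ->
  {in r, forall i, {in X i, forall x, (d %| x - c i)%Z}} ->
  {in r, forall i, forall z : int,
     exists2 x, x \in X i & (d * m%:Z %| x - c i - d * z)%Z} ->
  (\sum_(i <- r) `|l i| * #|` X i| <= #|` sumdil r l X| + size r * m)%N.
Proof.
move=> ur d0 m0 l0 lm bez Xd Xfull.
pose q i := (m %/ `|l i|)%N.
have qm i : i \in r -> m = (`|l i| * q i)%N.
  by move=> /lm lim; rewrite mulnC divnK.
have q0 i : i \in r -> (0 < q i)%N.
  by move=> ir; have := qm i ir; case: (q i) => //; rewrite muln0; lia.
pose XX i (w : int) := [fset x in X i | (d * (q i)%:Z %| x - c i - d * w)%Z].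
have sXX i w : XX i w `<=` X i by apply/fsubsetP => x; rewrite !inE => /andP[].
have XX0 i w : i \in r -> XX i w != fset0.
  move=> ir; have [x xX xd] := Xfull i ir w; apply/fset0Pn; exists x.
  rewrite !inE /= xX /=; apply: dvdz_trans xd.
  by rewrite {1}(qm i ir) PoszM; apply: dvdz_mul => //; apply: dvdz_mull.
pose T (rho s : nat) := sumdil r l (fun i => XX i (rho%:Z + s%:Z * u i)).
have sT rho s : T rho s `<=` sumdil r l X by apply: sumdilS => i _; apply: sXX.
pose base (rho : nat) := \sum_(i <- r) (c i + d * rho%:Z) * l i.
have Tcongr rho s x : x \in T rho s -> (d * m%:Z %| x - (base rho + d * s%:Z))%Z.
  move=> /(sumdilP _ _ _ ur)[a aX ->].
  have -> : base rho + d * s%:Z =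
      \sum_(i <- r) (c i + d * (rho%:Z + s%:Z * u i)) * l i.
    rewrite -[d * s%:Z]mulr1 -bez mulr_sumr -big_split /=.
    by apply: eq_bigr => i _; ring.
  rewrite -sumrB big_seq; apply: rpred_sum => i ir.
  have := aX i ir; rewrite !inE /= mulrzz => /andP[_ /dvdzP[e he]].
  have -> : a i * l i - (c i + d * (rho%:Z + s%:Z * u i)) * l i
     = (a i - c i - d * (rho%:Z + s%:Z * u i)) * l i by ring.
  rewrite he {1}(qm i ir) PoszM abszE.
  have [le|le] := leP 0 (l i).
    by rewrite ger0_norm //; apply/dvdzP; exists e; ring.
  by rewrite ltr0_norm //; apply/dvdzP; exists (- e); ring.
have S1 rho : (\sum_(s < m) \sum_(i <- r) #|` XX i (rho%:Z + (val s)%:Z * u i)%R|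
    <= #|` sumdil r l X| + m * size r)%N.
  have : (\sum_(s < m) #|` T rho s| <= #|` sumdil r l X|)%N.
    apply: sum_card_disjoint => // x s s' /Tcongr h /Tcongr h'.
    have := rpredB h' h.
    have -> : x - (base rho + d * (val s')%:Z) - (x - (base rho + d * (val s)%:Z))
       = d * ((val s)%:Z - (val s')%:Z) by rewrite /=; ring.
    rewrite dvdz_mul2l ?gt_eqF // => /dvdzP[e he].
    apply: val_inj => /=; have := ltn_ord s; have := ltn_ord s'.
    move: he => /=; case: (ltrgtP e 0) => [en|ep|->]; nia.
  move=> le; apply: leq_trans (leq_add le (leqnn _)).
  have -> : (m * size r = \sum_(s < m) size r)%N.
    by rewrite sum_nat_const card_ord.
  rewrite -big_split /=; apply: leq_sum => s _.
  by apply: card_sumdil_int => // i ir; apply: XX0.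
(* Write x = c i + d b. The shifts rho placing x in the prescribed class are those congruent to b -
   v modulo [q i], and m consecutive integers contain m / q i = |l i| of them. *)
have S2 i (v : int) : i \in r ->
    (`|l i| * #|` X i| <= \sum_(0 <= rho < m) #|` XX i (rho%:Z + v)%R|)%N.
  move=> ir; under eq_bigr => rho _ do rewrite cardf_sumE.
  rewrite exchange_big /= mulnC card_fset_sum1 big_distrl /=.
  rewrite big_seq [leqRHS]big_seq; apply: leq_sum => x xX; rewrite mul1n.
  have /dvdzP[b hb] := Xd i ir x xX.
  apply: leq_trans (count_congruent `|l i| (b - v) (q0 i ir)) _.
  rewrite -(qm i ir); apply: leq_sum => rho _.
  suff -> : (d * (q i)%:Z %| x - c i - d * (rho%:Z + v))%Z
     = ((q i)%:Z %| b - v - rho%:Z)%Z by [].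
  have -> : x - c i - d * (rho%:Z + v) = d * (b - v - rho%:Z) by rewrite hb; ring.
  by rewrite dvdz_mul2l // gt_eqF.
have S3 : (\sum_(0 <= rho < m) \sum_(s < m) \sum_(i <- r)
      #|` XX i (rho%:Z + (val s)%:Z * u i)%R|
    <= m * (#|` sumdil r l X| + m * size r))%N.
  have -> : (m * (#|` sumdil r l X| + m * size r)
     = \sum_(0 <= rho < m) (#|` sumdil r l X| + m * size r))%N.
    by rewrite sum_nat_const_nat subn0.
  by apply: leq_sum => rho _; apply: S1.
rewrite (mulnC (size r)) -(leq_pmul2l m0); apply: leq_trans S3.
rewrite exchange_big /=.
have -> : (m * (\sum_(i <- r) `|l i| * #|` X i|)
  = \sum_(s < m) \sum_(i <- r) `|l i| * #|` X i|)%N.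
  by rewrite sum_nat_const card_ord.
apply: leq_sum => s _; rewrite exchange_big /= big_seq [leqRHS]big_seq.
by apply: leq_sum => i ir; apply: S2.
Qed.

End IntegerSumsets.

(** * Residue classes and layer-cake summation *)

Section Residues.
Implicit Types A B C : {fset int}.

Definition resf (d : nat) A : {fset int} := [fset (x %% d)%Z | x in A].

Lemma eq_modz (d : nat) (x y : int) :
  ((x %% d)%Z == (y %% d)%Z) = (d%:Z %| x - y)%Z.
Proof. exact: eqz_mod_dvd. Qed.

Lemma mem_resf (d : nat) A x : x \in A -> (x %% d)%Z \in resf d A.
Proof. by move=> xA; apply/imfsetP; exists x. Qed.

Lemma resfP (d : nat) A y : reflect (exists2 x, x \in A & y = (x %% d)%Z) (y \in resf d A).
Proof. exact: imfsetP. Qed.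

Lemma resfS d A B : A `<=` B -> resf d A `<=` resf d B.
Proof.
by move=> /fsubsetP sAB; apply/fsubsetP => _ /resfP[x xA ->]; apply/mem_resf/sAB.
Qed.

Lemma card_resf_le d A : (#|` resf d A| <= #|` A|)%N.
Proof. exact: leq_imfset_card. Qed.

(** Chinese remainder theorem: above a residue modulo d1, a residue modulo d1 d2 is determined by
    its reduction modulo d2. *)
Lemma card_resf_fibers (d1 d2 : nat) A (n : nat) : coprime d1 d2 ->
  (forall x, x \in resf d1 A ->
     (#|` resf d2 [fset a in A | (a %% d1)%Z == x]| <= n)%N) ->
  (#|` resf (d1 * d2) A| <= #|` resf d1 A| * n)%N.
Proof.
move=> cop hn.
have modd1 (a : int) : ((a %% (d1 * d2)%N)%Z %% d1)%Z = (a %% d1)%Z.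
  apply/eqP; rewrite eq_modz {2}(divz_eq a (d1 * d2)%N).
  by apply/dvdzP; exists (- ((a %/ (d1 * d2)%N)%Z * d2)); rewrite PoszM; ring.
have modd2 (a : int) : ((a %% (d1 * d2)%N)%Z %% d2)%Z = (a %% d2)%Z.
  apply/eqP; rewrite eq_modz {2}(divz_eq a (d1 * d2)%N).
  by apply/dvdzP; exists (- ((a %/ (d1 * d2)%N)%Z * d1)); rewrite PoszM; ring.
rewrite -(@sum_card_fibers_eq _ _ (fun y : int => (y %% d1)%Z) _ (resf d1 A)).
  rewrite -sum1_size big_distrl /= big_seq [leqRHS]big_seq.
  apply: leq_sum => x xA; rewrite mul1n; apply: leq_trans (hn x xA).
  apply: (leq_cardf_inj (f := fun y : int => (y %% d2)%Z)).
    move=> y; rewrite !inE /= => /andP[/resfP[a aA ->]]; rewrite modd1 => ax.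
    by rewrite modd2; apply: mem_resf; rewrite !inE /= aA.
  move=> y y'; rewrite !inE /= => /andP[/resfP[a aA ->] /eqP ay].
  move=> /andP[/resfP[a' aA' ->] /eqP ay'] ; rewrite !modd2 => /eqP e2.
  move: ay; rewrite -ay' !modd1 => /eqP e1; apply/eqP; rewrite eq_modz PoszM.
  rewrite Gauss_dvdz; last by rewrite /coprimez /gcdz /= (eqP cop).
  by rewrite -!eq_modz e1.
by move=> _ /resfP[a aA ->]; rewrite modd1 mem_resf.
Qed.

Variable I : eqType.
Implicit Types (r : seq I) (l : I -> int).

(* Split d = d1 d2 with d1 prime to the first coefficient and d2 prime to the
   gcd of the others: the first dilate varies over all residues modulo d1, the
   other ones only over the richest fibre above a residue modulo d1. *)
Lemma card_resf_sumdil r l d C : (0 < d)%N -> {in r, forall i, l i != 0} ->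
  \big[gcdz/d%:Z]_(i <- r) l i = 1 ->
  (#|` resf d C| <= #|` resf d (sumdil r l (fun=> C))|)%N.
Proof.
elim: r d C => [|i r IH] d C d0 l0.
  rewrite big_nil => -[->]; apply: (@leq_trans 1).
    rewrite -[leqRHS](cardfs1 (0 : int)); apply: fsubset_leq_card.
    by apply/fsubsetP => _ /resfP[x _ ->]; rewrite inE modz1.
  rewrite cardfs_gt0; apply/fset0Pn; exists ((0 %% 1%N)%Z).
  by apply: mem_resf; rewrite /sumdil big_nil inE.
rewrite big_cons => g1.
have l0' : {in r, forall j, l j != 0} by move=> j jr; apply: l0; rewrite inE jr orbT.
have li : (0 < `|l i|)%N by rewrite absz_gt0 l0 // mem_head.
(* d2 collects the prime powers of d whose primes divide [l i]; the complementary part d1 is prime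
   to [l i]. *)
pose d2 := (d`_(\pi(`|l i|)))%N; pose d1 := (d`_(\pi(`|l i|)^'))%N.
have d12 : d = (d1 * d2)%N by rewrite mulnC partnC.
have d1_gt0 : (0 < d1)%N by apply: part_gt0.
have d2_gt0 : (0 < d2)%N by apply: part_gt0.
have cop : coprime d1 d2 by rewrite coprime_sym coprime_partC.
have copl : coprime `|l i| d1 by rewrite coprime_pi' // part_pnat.
have g2 : \big[gcdz/d2%:Z]_(j <- r) l j = 1.
  set g := \big[gcdz/_]_(j <- r) _.
  have gpos : g = `|g|%N.
    rewrite /g; case: (r) => [|? ?]; rewrite ?big_nil // big_cons.
    by rewrite /gcdz absz_nat.
  rewrite gpos; congr Posz; apply/eqP; apply: contraT => gn1.
  pose ell := pdiv `|g|.
  have gdiv (x : int) : (x %| g)%Z -> (x %| d2%:Z)%Z /\ {in r, forall j, (x %| l j)%Z}.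
    rewrite /g; elim: (r) => [|j s IHs]; first by rewrite big_nil.
    rewrite big_cons dvdz_gcd => /andP[xj /IHs[xd xs]]; split => // k.
    by rewrite inE => /predU1P[->|/xs].
  have g_gt0 : (0 < `|g|)%N.
    rewrite lt0n; apply/eqP => g0; have := (gdiv 0); rewrite gpos g0 => /(_ isT)[].
    by rewrite dvd0z; move: d2_gt0; lia.
  have ellP : prime ell by apply: pdiv_prime; move: gn1 g_gt0; lia.
  have [elld ellr] : (ell%:Z %| d2%:Z)%Z /\ {in r, forall j, (ell%:Z %| l j)%Z}.
    by apply: gdiv; rewrite dvdzE /= pdiv_dvd.
  have elli : (ell %| `|l i|)%N.
    have : ((\pi(`|l i|)).-nat d2)%N by apply: part_pnat.
    move=> /(pnatP _ d2_gt0) /(_ ell ellP elld).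
    by rewrite /= mem_primes => /and3P[].
  have : (ell%:Z %| (1 : int)%R)%Z.
    rewrite -g1 dvdz_gcd dvdzE /= elli /=.
    move: ellr; elim: (r) => [_|j s IHs es].
      by rewrite big_nil d12 PoszM dvdz_mull.
    rewrite big_cons dvdz_gcd es ?mem_head //=.
    by apply: IHs => k ks; apply: es; rewrite inE ks orbT.
  by rewrite dvdz1 /=; move: ellP; case: ell {elld ellr elli} => [|[]].
have [->|C0] := eqVneq C fset0.
  by rewrite /resf imfset0 cardfs0.
pose F (x : int) := [fset a in C | (a %% d1)%Z == x].
have res0 : resf d1 C != fset0.
  by have /fset0Pn[c cC] := C0; apply/fset0Pn; exists (c %% d1)%Z; apply: mem_resf.
have [x xC xmax] := exists_argminf (fun x => - (#|` resf d2 (F x)|%:R : rat)) res0.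
have {}xmax y : y \in resf d1 C -> (#|` resf d2 (F y)| <= #|` resf d2 (F x)|)%N.
  by move=> /xmax; rewrite lerN2 ler_nat.
rewrite {1}d12; apply: (leq_trans (card_resf_fibers cop xmax)).
apply: (leq_trans (leq_mul (leqnn _) (IH d2 (F x) d2_gt0 l0' g2))).
rewrite -cardfsM.
have /choice[cc ccP] : forall y, exists a, y \in resf d1 C ->
    a \in C /\ (a %% d1)%Z = y.
  move=> y; case: (boolP (y \in resf d1 C)) => [/resfP[a aC ->]|_]; last by exists 0.
  by exists a.
have /choice[ss ssP] : forall y, exists a,
    y \in resf d2 (sumdil r l (fun=> F x)) ->
    a \in sumdil r l (fun=> F x) /\ (a %% d2)%Z = y.
  move=> y; case: (boolP (y \in resf d2 _)) => [/resfP[a aC ->]|_]; last by exists 0.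
  by exists a.
have sFx : F x `<=` C by apply/fsubsetP => a; rewrite !inE => /andP[].
apply: (leq_cardf_inj (f := fun yz => ((cc yz.1 * l i + ss yz.2) %% d)%Z)).
  move=> [y z]; rewrite in_fsetM /= => /andP[/ccP[yC _] /ssP[zS _]].
  apply: mem_resf; rewrite sumdil_cons; apply: mem_addf.
    by rewrite -mulrzz; apply: mem_dilf.
  by apply: (fsubsetP (sumdilS _ _)) zS => j _.
(* Sums over the fibre [F x] are all congruent modulo d1, so modulo d1 only the first dilate varies.
   As [l i] is invertible there, y is recovered first, and then z modulo d2. *)
have ssd1 z : z \in resf d2 (sumdil r l (fun=> F x)) ->
    (d1%:Z %| ss z - \sum_(j <- r) x * l j)%Z.
  move=> /ssP[zS _]; apply: (sumdil_congr (c := fun=> x)) zS => j jr a.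
  rewrite !inE /= => /andP[aC /eqP <-]; rewrite -eq_modz modz_mod //.
move=> [y z] [y' z']; rewrite !in_fsetM /= => /andP[yC zS] /andP[yC' zS'].
move=> /eqP; rewrite eq_modz {1}d12 PoszM Gauss_dvdz; last first.
  by rewrite /coprimez /gcdz /= (eqP cop).
move=> /andP[h1 h2].
have [_ ey] := ccP _ yC; have [_ ey'] := ccP _ yC'.
have [_ ez] := ssP _ zS; have [_ ez'] := ssP _ zS'.
have eyy : y = y'.
  apply/eqP; rewrite -ey -ey' eq_modz.
  rewrite -(@Gauss_dvdzl _ _ (l i)); last first.
    by rewrite /coprimez /gcdz /= gcdnC (eqP copl).
  have -> : (cc y - cc y') * l i = (cc y * l i + ss z - (cc y' * l i + ss z'))
     - ((ss z - \sum_(j <- r) x * l j) - (ss z' - \sum_(j <- r) x * l j)) by ring.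
  by apply: rpredB => //; apply: rpredB; apply: ssd1.
rewrite eyy; congr (_, _); apply/eqP; rewrite -ez -ez' eq_modz.
by move: h2; rewrite eyy opprD addrACA subrr add0r.
Qed.

(** For each s, the classes with more than s elements have sums of dilates in at least as many
    classes; each such class y contains at least L (s + 1) - O(1) elements of S. Counting the values
    of s that reach y then gives L |A|. *)
Lemma card_sumdil_full r l d m A : uniq r -> (0 < d)%N -> (0 < m)%N ->
  {in r, forall i, l i != 0} -> {in r, forall i, (`|l i| %| m)%N} ->
  \big[gcdz/0]_(i <- r) l i = 1 ->
  (forall a, a \in A -> forall z : int,
     exists2 b, b \in A & (d%:Z * m%:Z %| b - a - d%:Z * z)%Z) ->
  ((\sum_(i <- r) `|l i|) * #|` A| <= #|` sumdil r l (fun=> A)|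
      + #|` resf d A| ^ size r * (size r * m))%N.
Proof.
move=> ur d0 m0 l0 lm g1 Afull.
have [u bez] := bezout_seq l ur; rewrite g1 in bez.
set L := (\sum_(i <- r) `|l i|)%N; set S := sumdil r l _.
pose C := resf d A; pose cl (c : int) := [fset a in A | (a %% d)%Z == c].
pose n := #|` A|.
pose Cs (s : nat) := [fset c in C | (s < #|` cl c|)%N].
have sCs s : Cs s `<=` C by apply/fsubsetP => c; rewrite !inE => /andP[].
have resC c : c \in C -> (c %% d)%Z = c by move=> /resfP[a aA ->]; rewrite modz_mod.
pose Ys s := resf d (sumdil r l (fun=> Cs s)).
pose Y := resf d (sumdil r l (fun=> C)).
have sYs s : Ys s `<=` Y by apply/resfS/sumdilS => i _; apply: sCs.
have gd : \big[gcdz/d%:Z]_(i <- r) l i = 1.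
  have -> : \big[gcdz/d%:Z]_(i <- r) l i = gcdz (\big[gcdz/0]_(i <- r) l i) d%:Z.
    elim: (r) => [|i s IHs]; first by rewrite !big_nil gcd0z.
    by rewrite !big_cons IHs gcdzA.
  by rewrite g1 gcd1z.
(* Layer cake: |A| is the sum over s of the number of classes with more than s elements. *)
have cardA : (#|` A| <= \sum_(s < n) #|` Ys s|)%N.
  have -> : #|` A| = (\sum_(s < n) #|` Cs s|)%N.
    under [RHS]eq_bigr => s _ do rewrite cardf_sumE.
    rewrite exchange_big /= -(@sum_card_fibers_eq _ _ (fun a : int => (a %% d)%Z) A C).
      apply: eq_bigr => c _.
      have le : (#|` cl c| <= n)%N by apply/fsubset_leq_card/fsubsetP => a; rewrite !inE => /andP[].
      rewrite -(big_mkord xpredT (fun s => nat_of_bool (s < #|` cl c|)%N)).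
      rewrite (big_cat_nat (n := #|` cl c|)) //=.
      rewrite (eq_big_nat _ _ (F2 := fun=> 1%N)); last by move=> s /andP[_ ->].
      rewrite [X in (_ + X)%N](eq_big_nat _ _ (F2 := fun=> 0%N)); last first.
        by move=> s /andP[h _]; rewrite ltnNge h.
      by rewrite !sum_nat_const_nat muln0 addn0 muln1 subn0.
    by move=> a aA; apply: mem_resf.
  apply: leq_sum => s _; apply: leq_trans (card_resf_sumdil _ d0 l0 gd).
  apply: fsubset_leq_card; apply/fsubsetP => c cC.
  by apply/resfP; exists c => //; rewrite resC // (fsubsetP (sCs s)).
(* Take classes [c i] whose combination is y: the sum of their dilates stays in the fibre of S over
   y, and the averaging bound applies since they are full. *)
have key y s : y \in Ys s ->
    (L * s.+1 <= #|` [fset x in S | (x %% d)%Z == y]| + size r * m)%N.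
  move=> /resfP[_ /(sumdilP _ _ _ ur)[c cC ->] ->].
  have cCi i : i \in r -> c i \in C /\ (s < #|` cl (c i)|)%N.
    by move=> /cC; rewrite !inE /= => /andP[].
  have cld i : i \in r -> {in cl (c i), forall x, (d%:Z %| x - c i)%Z}.
    move=> /cCi[ciC _] x; rewrite !inE /= => /andP[_ /eqP e].
    by rewrite -eq_modz e resC.
  have dz : 0 < d%:Z by rewrite ltz_nat.
  have full := card_sumdil_full_classes ur dz m0 l0 lm bez cld.
  apply: (@leq_trans (\sum_(i <- r) `|l i| * #|` cl (c i)|)%N).
    rewrite /L big_distrl /= big_seq [leqRHS]big_seq; apply: leq_sum => i ir.
    by rewrite leq_mul2l (cCi i ir).2 orbT.
  apply: (leq_trans (full _)); last first.
    rewrite leq_add2r; apply: fsubset_leq_card; apply/fsubsetP => x xS.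
    rewrite !inE /=; apply/andP; split.
      by apply: (fsubsetP (sumdilS _ _)) xS => i _; apply/fsubsetP => a; rewrite !inE => /andP[].
    rewrite eq_modz; under eq_bigr => i _ do rewrite mulrzz.
    exact: (sumdil_congr cld).
  move=> i ir z; have [/resfP[a aA ea] _] := cCi i ir.
  have da : (d%:Z %| a - c i)%Z by rewrite ea -eq_modz modz_mod.
  have /dvdzP[e he] := da.
  have [b bA hb] := Afull a aA (z - e).
  have hb' : (d%:Z * m%:Z %| b - c i - d%:Z * z)%Z.
    suff -> : b - c i - d%:Z * z = b - a - d%:Z * (z - e) by [].
    have -> : a = c i + e * d%:Z by rewrite -he; ring.
    ring.
  exists b => //; rewrite !inE /= bA /= -(resC (c i)); last exact: (cCi i ir).1.
  rewrite eq_modz.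
  have : (d%:Z %| b - c i - d%:Z * z)%Z by apply: dvdz_trans hb'; apply: dvdz_mulr.
  move=> h; have := rpredD h (dvdz_mulr z (dvdzz d%:Z)).
  by rewrite subrK.
have fib y : y \in Y ->
    (L * \sum_(s < n) (y \in Ys s) <= #|` [fset x in S | (x %% d)%Z == y]| + size r * m)%N.
  move=> yY; set f := (\sum_(s < n) _)%N.
  case ef : f => [|t]; first by rewrite muln0.
  (* Among t + 1 distinct values of s, one is at least t, and [key] at that value yields L (t +
     1). *)
  have [s [yYs ts]] : exists s, y \in Ys s /\ (t <= s)%N.
    apply: contrapT => nex; suff : (f <= t)%N by rewrite ef ltnn.
    apply: (@leq_trans (\sum_(0 <= s < n) (s < t))%N).
      rewrite big_mkord; apply: leq_sum => s _; case: (boolP (y \in Ys s)) => // yYs.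
      rewrite lt0b ltnNge; apply/negP => ts; apply: nex; exists s; split => //.
    have h k : (\sum_(0 <= s < k) (s < t) <= t)%N.
      elim: k => [|k IHk]; first by rewrite big_nil.
      rewrite big_nat_recr //=; case: (ltnP k t) => [kt|]; last by rewrite addn0.
      rewrite addn1; apply: leq_ltn_trans kt; elim: (k) => [|k' IH]; rewrite ?big_nil //.
      by rewrite big_nat_recr //= -addn1; apply: leq_add => //; apply: leq_b1.
    exact: h.
  by apply: leq_trans (key _ _ yYs); rewrite leq_mul2l ltnS ts orbT.
apply: (@leq_trans (L * \sum_(s < n) #|` Ys s|)%N).
  by rewrite leq_mul2l cardA orbT.
have -> : (\sum_(s < n) #|` Ys s| = \sum_(y <- Y) \sum_(s < n) (y \in Ys s))%N.
  rewrite exchange_big /=; apply: eq_bigr => s _; rewrite -cardf_sumE.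
  congr (#|` _|); apply/fsetP => y; rewrite !inE /=.
  by apply/idP/andP => [yYs|[]//]; split => //; apply: (fsubsetP (sYs s)).
rewrite big_distrr /=.
apply: (@leq_trans (\sum_(y <- Y) (#|` [fset x in S | (x %% d)%Z == y]| + size r * m))%N).
  by rewrite big_seq [leqRHS]big_seq; apply: leq_sum.
rewrite big_split /= leq_add ?sum_card_fibers_le //.
rewrite big_const_seq count_predT iter_addn_0 mulnC leq_mul2r.
apply/orP; right; apply: leq_trans (card_resf_le _ _) _.
exact: card_sumdil_le.
Qed.

End Residues.

(** * Refining residue classes *)

(** Put n = j (k + 1) and h = x - 1. Bernoulli gives x^n at least (j h)^(k + 1), one more power of j
    than the polynomial has, so a large j wins. *)
Lemma exp_beats_poly (R : archiRealFieldType) (x : R) (a c k : nat) : 1 < x ->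
  exists2 n, (0 < n)%N & (c * (a * n + 1) ^ k)%:R < x ^+ n.
Proof.
move=> x1; pose h := x - 1; have h0 : 0 < h by rewrite subr_gt0.
pose b := (a * k.+1 + 1)%N.
pose j := (Num.Def.archi_bound ((c * b ^ k)%:R / h ^+ k.+1)).+1.
have jP : (c * b ^ k)%:R < j%:R * h ^+ k.+1.
  rewrite -ltr_pdivrMr ?exprn_gt0 //.
  apply: (@lt_le_trans _ _ (Num.Def.archi_bound ((c * b ^ k)%:R / h ^+ k.+1))%:R).
    by rewrite archi_boundP // divr_ge0 // exprn_ge0 // ltW.
  by rewrite ler_nat.
have bern m : m%:R * h <= x ^+ m.
  suff : 1 + m%:R * h <= x ^+ m by apply: le_trans; rewrite lerDr.
  elim: m => [|m IH]; first by rewrite mul0r addr0 expr0.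
  rewrite exprS; apply: le_trans (ler_wpM2l (ltW (lt_trans ltr01 x1)) IH).
  have : 0 <= h * (m%:R * h) by rewrite !mulr_ge0 // ltW.
  by rewrite -natr1 /h; nra.
exists (j * k.+1)%N => //.
apply: (@lt_le_trans _ _ ((j%:R * h) ^+ k.+1)); last first.
  rewrite exprM lerXn2r // ?nnegrE ?exprn_ge0 ?mulr_ge0 // ?ltW //.
  exact: lt_trans x1.
apply: (@le_lt_trans _ _ (j ^ k * (c * b ^ k))%:R); last first.
  by rewrite natrM exprMn exprSr -mulrA natrX ltr_pM2l // exprn_gt0 // ltr0n.
rewrite ler_nat (mulnCA (j ^ k)%N) -expnMn leq_mul2l; apply/orP; right.
have le : (a * (j * k.+1) + 1 <= j * b)%N.
  by rewrite /b mulnDr muln1 mulnCA leq_add2l.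
by have [->|k0] := posnP k; rewrite ?expn0 // leq_exp2r.
Qed.

Lemma card_resf_mul (e m : nat) (B : {fset int}) : (0 < e)%N -> (0 < m)%N ->
  (#|` resf (m * e) B| <= m * #|` resf e B|)%N.
Proof.
move=> e0; case: m => // m _.
have -> : (m.+1 * #|` resf e B| =
   #|` resf e B `*` [fset i in {: 'I_m.+1}]|)%N.
  by rewrite cardfsM card_finset card_ord mulnC.
have me0 : (0 < m.+1 * e)%N by rewrite muln_gt0.
apply: (leq_cardf_inj (f := fun y : int => ((y %% e)%Z, inord `|(y %/ e)%Z|))).
  move=> _ /resfP[b bB ->]; rewrite in_fsetM /= !inE andbT.
  apply/resfP; exists b => //; apply/eqP; rewrite eq_modz {2}(divz_eq b (m.+1 * e)%N).
  by apply/dvdzP; exists (- ((b %/ (m.+1 * e)%N)%Z * m.+1)); rewrite PoszM; ring.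
have bnd y : y \in resf (m.+1 * e) B ->
    [/\ 0 <= (y %/ e)%Z & (`|(y %/ e)%Z| < m.+1)%N].
  move=> /resfP[b bB ->]; set z := (b %% _)%Z.
  have z0 : 0 <= z by apply: modz_ge0; lia.
  have zm : z < (m.+1 * e)%N%:Z by apply: ltz_pmod; lia.
  have ze := divz_eq z e; have z1 : 0 <= (z %% e)%Z by apply: modz_ge0; lia.
  have d0 : 0 <= (z %/ e)%Z by rewrite divz_ge0 ?ltz_nat.
  split => //.
  have : (z %/ e)%Z * e%:Z < m.+1%:Z * e%:Z by rewrite -PoszM; apply: le_lt_trans zm; lia.
  by rewrite ltr_pM2r ?ltz_nat //; lia.
move=> y y' /bnd[y0 ym] /bnd[y0' ym'] [e1] /(congr1 val).
rewrite /= !inordK // => e2.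
rewrite (divz_eq y e) (divz_eq y' e) e1; congr (_ * _ + _).
by move: e2; lia.
Qed.

Section Levels.
Variables (A : {fset int}) (M : nat).
Hypotheses (M1 : (1 < M)%N) (A0 : A != fset0).
Let D := addf A (oppf A).

Definition diffs (d : nat) : {fset int} := [fset x in D | (d%:Z %| x)%Z].
(** The value is 0 exactly when distinct elements of A are incongruent modulo [d]; hence the
    positivity assumptions on levels below. *)
Definition diffgcd (d : nat) : nat := absz (\big[gcdz/0]_(x <- diffs d) x).

(* Passing from modulus d to modulus [diffgcd d] does not change the partition
   of A into classes; afterwards the differences inside classes are coprime. *)
Fixpoint level (t : nat) : nat :=
  if t is t'.+1 then diffgcd (M * level t') else diffgcd 1.

Lemma mem_diff a b : a \in A -> b \in A -> a - b \in D.
Proof. by move=> aA bA; apply: mem_addf => //; rewrite mem_oppf opprK. Qed.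

Lemma mem0_diff : 0 \in D.
Proof. by have /fset0Pn[a aA] := A0; rewrite -(subrr a) mem_diff. Qed.

Lemma dvdz_big_gcd (T : Type) (s : seq T) (f : T -> int) (z : int) :
  (z %| \big[gcdz/0]_(x <- s) f x)%Z = all (fun x => z %| f x)%Z s.
Proof.
elim: s => [|x s IH]; first by rewrite big_nil dvdz0.
by rewrite big_cons dvdz_gcd IH.
Qed.

Lemma dvdz_diffgcd (d : nat) (z : int) :
  (z %| (diffgcd d)%:Z)%Z = all (fun x => z %| x)%Z (diffs d).
Proof. by rewrite -(dvdz_big_gcd _ id) !dvdzE. Qed.

Lemma diffgcd_dvd d x : x \in diffs d -> ((diffgcd d)%:Z %| x)%Z.
Proof.
by move: x; apply/allP; rewrite -dvdz_diffgcd.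
Qed.

Lemma diffgcd_mult d : (d%:Z %| (diffgcd d)%:Z)%Z.
Proof.
by rewrite dvdz_diffgcd; apply/allP => x; rewrite !inE => /andP[].
Qed.

Lemma diffgcd_congr d a b : a \in A -> b \in A -> (d%:Z %| a - b)%Z ->
  ((diffgcd d)%:Z %| a - b)%Z.
Proof.
by move=> aA bA dab; apply: diffgcd_dvd; rewrite !inE /= mem_diff.
Qed.

Lemma mem_nsumf_mul (x : int) n : x \in D -> x * n%:Z \in nsumf n D.
Proof.
move=> xD; elim: n => [|n IH]; first by rewrite mulr0 inE.
by rewrite -add1n PoszD mulrDr mulr1; apply: mem_addf.
Qed.

Lemma sum_mem_nsumf (s : seq int) (x : int -> int) (n : int -> nat) N :
  {in s, forall y, x y \in D} -> (forall y, (n y <= N)%N) ->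
  \sum_(y <- s) x y * (n y)%:Z \in nsumf (size s * N) D.
Proof.
move=> xD nN; elim: s xD => [|y s IH] xD; first by rewrite big_nil inE.
rewrite big_cons /= mulSn nsumfD; apply: mem_addf; last first.
  by apply: IH => z zs; apply: xD; rewrite inE zs orbT.
apply: (fsubsetP (nsumf_leq mem0_diff (nN y))).
by apply: mem_nsumf_mul; apply: xD; rewrite mem_head.
Qed.

(* Bezout modulo M g needs one difference per residue class, each with a
   coefficient below M. *)
Lemma complete_residues d (g := diffgcd d) (z : int) : (0 < g)%N ->
  exists2 e, e \in nsumf (M * M) D & ((M * g)%N%:Z %| e - g%:Z * z)%Z.
Proof.
move=> g0; have M0 : (0 < M)%N by apply: ltnW.
pose Res := resf (M * g) (diffs d).
(* All these differences vanish modulo [g], which leaves at most M residues modulo [M * g]; hence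
   the M * M summands. *)
have cRes : (#|` Res| <= M)%N.
  apply: (leq_trans (card_resf_mul _ g0 M0)); rewrite -{2}(muln1 M) leq_mul2l.
  apply/orP; right; rewrite -[leqRHS](cardfs1 (0 : int)).
  apply: fsubset_leq_card; apply/fsubsetP => _ /resfP[x xd ->].
  by rewrite inE; apply/eqP/dvdz_mod0P/diffgcd_dvd.
have /choice[rep repP] : forall y, exists x, y \in Res ->
    x \in diffs d /\ (x %% (M * g)%N)%Z = y.
  move=> y; case: (boolP (y \in Res)) => [/resfP[x xd ->]|_]; last by exists 0.
  by exists x.
have [u eu] := bezout_seq rep (fset_uniq Res).
set G := \big[gcdz/0]_(y <- _) _ in eu.
have Gdvd : (gcdz G (M * g)%N %| g%:Z)%Z.
  rewrite dvdz_diffgcd; apply/allP => x xd.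
  have xR : (x %% (M * g)%N)%Z \in Res by apply: mem_resf.
  have [_ /eqP] := repP _ xR; rewrite eq_modz -rpredN opprB => h.
  rewrite -(subrK (rep (x %% (M * g)%N)%Z) x); apply: rpredD.
    exact: dvdz_trans (dvdz_gcdr _ _) h.
  apply: dvdz_trans (dvdz_gcdl _ _) _.
  have := dvdzz G; rewrite {2}/G dvdz_big_gcd => /allP; exact.
have dvdG : (g%:Z %| gcdz G (M * g)%N)%Z.
  rewrite dvdz_gcd; apply/andP; split; last by rewrite PoszM dvdz_mull.
  rewrite -eu big_seq; apply: rpred_sum => y yR.
  by apply: dvdz_mulr; apply: diffgcd_dvd; case: (repP _ yR).
have gE : gcdz G (M * g)%N = g.
  by congr Posz; apply/eqP; rewrite eqn_dvd; apply/andP; split.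
have [a [b ab]] := Bezoutz G (M * g)%N; rewrite gE in ab.
(* Each [rep y] is a multiple of [g], so reducing its coefficient modulo M changes the sum by a
   multiple of [M * g] and makes it a natural number below M. *)
pose n y := `|((z * a * u y) %% M)%Z|%N.
have nE y : (n y)%:Z = ((z * a * u y) %% M)%Z.
  by rewrite /n gez0_abs // modz_ge0 //; lia.
exists (\sum_(y <- Res) rep y * (n y)%:Z).
  apply: (fsubsetP (nsumf_leq mem0_diff (leq_mul cRes (leqnn M)))).
  apply: sum_mem_nsumf => [y yR|y].
    by have [] := repP _ yR; rewrite !inE /= => /andP[].
  by rewrite -lez_nat nE ltW // ltz_pmod //; lia.
have -> : g%:Z * z = \sum_(y <- Res) rep y * (z * a * u y) + z * b * (M * g)%N.
  rewrite -ab mulrDl; congr (_ + _); last by ring.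
  by rewrite -eu mulr_sumr mulr_suml; apply: eq_bigr => y _; ring.
rewrite opprD addrA -sumrB; apply: rpredB; last by rewrite dvdz_mull.
rewrite big_seq; apply: rpred_sum => y yR; rewrite nE -mulrBr mulnC PoszM.
apply: dvdz_mul; first by apply: diffgcd_dvd; case: (repP _ yR).
by rewrite -eq_modz modz_mod.
Qed.

Lemma level_dvd t : (M * level t %| level t.+1)%N.
Proof. by have := diffgcd_mult (M * level t); rewrite dvdzE. Qed.

Lemma level_congr t a b : a \in A -> b \in A ->
  ((M * level t)%N%:Z %| a - b)%Z -> ((level t.+1)%:Z %| a - b)%Z.
Proof. exact: diffgcd_congr. Qed.

Lemma level0_congr a b : a \in A -> b \in A -> ((level 0)%:Z %| a - b)%Z.
Proof. by move=> aA bA; apply: diffgcd_congr => //; rewrite dvd1z. Qed.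

Lemma level_complete_residues t (z : int) : (0 < level t)%N ->
  exists2 e, e \in nsumf (M * M) D &
    ((M * level t)%N%:Z %| e - (level t)%:Z * z)%Z.
Proof. by case: t => [|t] lt; apply: complete_residues. Qed.

Lemma level_gt0 t T : (t <= T)%N -> (0 < level T)%N -> (0 < level t)%N.
Proof.
move=> /subnK <-; elim: (T - t)%N => [//|k IH]; rewrite addSn => lk; apply: IH.
rewrite lt0n; apply: contraL lk => /eqP l0.
by have := level_dvd (k + t); rewrite l0 muln0 dvd0n => /eqP ->.
Qed.

(** Each level multiplies the number of classes by at most M: going from [M * level t] on to
    [level t.+1] splits no class. *)
Lemma card_resf_level t : (#|` resf (level t) A| <= M ^ t)%N.
Proof.
have M0 : (0 < M)%N by apply: ltnW.
have sub (d e : nat) :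
    (forall a b, a \in A -> b \in A -> (d%:Z %| a - b)%Z -> (e%:Z %| a - b)%Z) ->
    (#|` resf e A| <= #|` resf d A|)%N.
  move=> de.
  have /choice[rep repP] : forall y, exists x, y \in resf e A ->
      x \in A /\ (x %% e)%Z = y.
    move=> y; case: (boolP (y \in resf e A)) => [/resfP[x xd ->]|_]; last by exists 0.
    by exists x.
  apply: (leq_cardf_inj (f := fun y => (rep y %% d)%Z)).
    by move=> y /repP[yA _]; apply: mem_resf.
  move=> y y' /repP[yA ey] /repP[yA' ey'] /eqP; rewrite eq_modz => h.
  by apply/eqP; rewrite -ey -ey' eq_modz; apply: de.
elim: t => [|t IH].
  apply: (@leq_trans #|` resf 1 A|).
    by apply: sub => a b aA bA _; apply: level0_congr.
  rewrite -[leqRHS](cardfs1 (0 : int)); apply: fsubset_leq_card.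
  by apply/fsubsetP => _ /resfP[x _ ->]; rewrite inE modz1.
apply: (@leq_trans #|` resf (M * level t) A|); first exact/sub/level_congr.
have [l0|lt] := posnP (level t).
  rewrite l0 muln0; apply: (@leq_trans (M ^ t)); first by rewrite -l0.
  by rewrite leq_exp2l.
apply: leq_trans (card_resf_mul _ lt M0) _.
by rewrite expnS leq_mul2l IH orbT.
Qed.

(** A zero modulus would separate all elements of A, giving |A| classes where at most M^t are
    possible. *)
Lemma level_gt0_of_card t : (M ^ t < #|` A|)%N -> (0 < level t)%N.
Proof.
rewrite lt0n; apply: contraL => /eqP l0; rewrite -leqNgt.
apply: leq_trans (card_resf_level t); rewrite l0.
apply: (leq_cardf_inj (f := id)) => // x xA.
by apply/resfP; exists x => //; rewrite modz0.
Qed.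

Definition lclass t (x : int) : {fset int} :=
  [fset a in A | ((level t)%:Z %| a - x)%Z].

Lemma mem_lclass t x a :
  (a \in lclass t x) = (a \in A) && ((level t)%:Z %| a - x)%Z.
Proof. by rewrite !inE. Qed.

Lemma lclass_eq t x a : a \in lclass t x -> lclass t a = lclass t x.
Proof.
rewrite mem_lclass => /andP[aA ax]; apply/fsetP => b; rewrite !mem_lclass.
case: (b \in A) => //=; apply/idP/idP => h.
  by have := rpredD h ax; rewrite addrA subrK.
by have := rpredB h ax; rewrite opprB addrA subrK.
Qed.

(** Descend from level T to level 0. A set inside one class modulo [M * level t] has M disjoint
    translates by elements of M^2 D representing the multiples of [level t] modulo [M * level t],
    and their union lies in one class modulo [level t]. *)
Lemma card_lclass_growth T x : (0 < level T)%N ->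
  (M ^ T * #|` lclass T x| <= #|` addf A (nsumf (T * (M * M)) D)|)%N.
Proof.
move=> lT.
suff H : forall j, (j <= T)%N -> exists B : {fset int},
    [/\ B `<=` addf A (nsumf (j * (M * M)) D),
        {in B, forall b, ((level (T - j))%:Z %| b - x)%Z} &
        #|` B| = (M ^ j * #|` lclass T x|)%N].
  have [B [sB _ <-]] := H T (leqnn T).
  exact: fsubset_leq_card.
elim=> [_|j IH jT].
  exists (lclass T x); split; last by rewrite mul1n.
    rewrite mul0n addfC add0f; apply/fsubsetP => a; rewrite mem_lclass.
    by case/andP.
  by move=> b; rewrite subn0 mem_lclass => /andP[].
have [B [sB Bx cB]] := IH (ltnW jT).
set t := (T - j.+1)%N; have tE : (T - j = t.+1)%N by rewrite /t; lia.
have lt : (0 < level t)%N by apply: level_gt0 lT; rewrite leq_subr.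
rewrite tE in Bx.
have /choice[e eP] : forall z : int, exists e, e \in nsumf (M * M) D /\
    ((M * level t)%N%:Z %| e - (level t)%:Z * z)%Z.
  by move=> z; have [e] := level_complete_residues z lt; exists e.
pose B' := [fset e (val u.1)%:Z + u.2 | u in [fset i in {: 'I_M}] `*` B].
have Mx b : b \in B -> ((M * level t)%N%:Z %| b - x)%Z.
  by move=> /Bx; apply: dvdz_trans; have := level_dvd t; rewrite dvdzE.
exists B'; split.
- apply/fsubsetP => _ /imfsetP[[i b] /= + ->]; rewrite in_fsetM /= !inE /= => bB.
  rewrite mulSn nsumfD addfA (addfC A) -addfA; apply: mem_addf.
    by have [] := eP (val i)%:Z.
  exact: (fsubsetP sB).
- move=> _ /imfsetP[[i b] /= + ->]; rewrite in_fsetM /= !inE /= => bB.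
  have [_ h] := eP (val i)%:Z.
  have h1 : ((level t)%:Z %| e (val i)%:Z - (level t)%:Z * (val i)%:Z)%Z.
    by apply: dvdz_trans h; rewrite PoszM dvdz_mull.
  have h2 : ((level t)%:Z %| b - x)%Z.
    by apply: dvdz_trans (Mx b bB); rewrite PoszM dvdz_mull.
  have h3 : ((level t)%:Z %| (level t)%:Z * (val i)%:Z)%Z by apply: dvdz_mulr.
  by have := rpredD (rpredD h1 h3) h2; rewrite subrK addrA.
- rewrite card_in_imfset /=.
    by rewrite cardfsM card_finset card_ord cB expnS mulnA.
  move=> [i b] [i' b']; rewrite !in_fsetM /= !inE /= => bB bB' eq.
  have [_ h] := eP (val i)%:Z; have [_ h'] := eP (val i')%:Z.
  have ei : i = i'.
    have := rpredB (rpredB h' h) (rpredB (Mx _ bB) (Mx _ bB')).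
    have -> : e (val i')%:Z - (level t)%:Z * (val i')%:Z -
        (e (val i)%:Z - (level t)%:Z * (val i)%:Z) - (b - x - (b' - x))
      = (e (val i')%:Z + b' - (e (val i)%:Z + b)) +
        (level t)%:Z * ((val i)%:Z - (val i')%:Z) by ring.
    rewrite -eq subrr add0r mulnC PoszM dvdz_mul2l; last by lia.
    move=> /dvdzP[w hw]; apply: val_inj => /=.
    have := ltn_ord i; have := ltn_ord i'; move: hw => /=.
    by case: (ltrgtP w 0) => [wn|wp|->]; nia.
  by move: eq; rewrite ei => /addrI ->.
Qed.

Definition nsub t x := #|` resf (M * level t) (lclass t x)|.

Lemma nsub_le t x : (0 < level t)%N -> (nsub t x <= M)%N.
Proof.
move=> lt; have M0 : (0 < M)%N by apply: ltnW.
apply: (leq_trans (card_resf_mul _ lt M0)); rewrite -{2}(muln1 M) leq_mul2l.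
apply/orP; right; rewrite -[leqRHS](cardfs1 (x %% level t)%Z).
apply: fsubset_leq_card; apply/fsubsetP => _ /resfP[a + ->].
by rewrite mem_lclass inE eq_modz => /andP[].
Qed.

Lemma nsub_full t x : (0 < level t)%N -> nsub t x = M -> forall z : int,
  exists2 b, b \in lclass t x & ((level t)%:Z * M%:Z %| b - x - (level t)%:Z * z)%Z.
Proof.
move=> lt full z; have M0 : (0 < M)%N by apply: ltnW.
pose R := [fset ((x + (level t)%:Z * (val i)%:Z) %% (M * level t)%N)%Z |
             i in [fset i in {: 'I_M}]].
have sR : resf (M * level t) (lclass t x) `<=` R.
  apply/fsubsetP => _ /resfP[a + ->]; rewrite mem_lclass => /andP[_ /dvdzP[w hw]].
  have w0 : 0 <= (w %% M)%Z by apply: modz_ge0; lia.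
  have wM : (w %% M)%Z < M by apply: ltz_pmod; lia.
  have wM' : (`|(w %% M)%Z| < M)%N by lia.
  apply/imfsetP; exists (Ordinal wM'); first by rewrite !inE.
  apply/eqP; rewrite eq_modz /= gez0_abs // opprD addrA hw mulrC -mulrBr.
  by rewrite mulnC PoszM dvdz_mul2l -?eq_modz ?modz_mod //; lia.
have cR : (#|` R| <= M)%N.
  apply: (@leq_trans #|` [fset i in {: 'I_M}]|); first exact: leq_imfset_card.
  by rewrite card_finset card_ord.
have eR : resf (M * level t) (lclass t x) = R.
  by apply/eqP; rewrite eqEfcard sR /=; move: full; rewrite /nsub => ->.
have w0 : 0 <= (z %% M)%Z by apply: modz_ge0; lia.
have wM : (z %% M)%Z < M by apply: ltz_pmod; lia.
have wM' : (`|(z %% M)%Z| < M)%N by lia.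
have : ((x + (level t)%:Z * (val (Ordinal wM'))%:Z) %% (M * level t)%N)%Z \in R.
  by apply/imfsetP; exists (Ordinal wM') => //; rewrite !inE.
rewrite -eR => /resfP[b bx /eqP]; rewrite eq_modz /= gez0_abs // => h.
exists b => //; move: h; rewrite -rpredN opprB mulnC PoszM => h.
have h2 : ((level t)%:Z * M%:Z %| (level t)%:Z * ((z %% M)%Z - z))%Z.
  by rewrite dvdz_mul2l -?eq_modz ?modz_mod //; lia.
have := rpredD h h2; congr (_ %| _)%Z; ring.
Qed.

(** A class missing a subclass has at most M - 1 of them; the weight [theta] raises their total back
    to M. *)
Let theta : rat := M%:R / M.-1%:R.

Definition nbad T t a := (\sum_(t <= s < T) (nsub s a != M))%N.

(* Each non-full class has at most M - 1 subclasses. *)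
Lemma sum_theta_nbad T (m : nat) : (0 < level T)%N ->
  (forall a, a \in A -> (#|` lclass T a| <= m)%N) ->
  forall j, (j <= T)%N -> forall x, x \in A ->
  \sum_(a <- lclass (T - j) x) theta ^+ nbad T (T - j) a <= (M ^ j * m)%:R.
Proof.
move=> lT hm; elim=> [_ x xA|j IH jT x xA].
  rewrite subn0 mul1n; under eq_bigr => a _ do rewrite /nbad big_geq // expr0.
  by rewrite big_const_seq count_predT iter_addr addr0 ler_nat hm.
set t := (T - j.+1)%N; have tE : (T - j = t.+1)%N by rewrite /t; lia.
have lt : (0 < level t)%N by apply: level_gt0 lT; rewrite leq_subr.
have tT : (t < T)%N by rewrite /t; lia.
rewrite tE in IH.
pose h (a : int) := (a %% (M * level t)%N)%Z.
rewrite (partition_big_imfset _ h) /=.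
(* The elements of the class sharing a residue modulo [M * level t] lie in one class of level
   [t.+1], where induction applies; level t itself adds the same factor to all of them. *)
have inner y : y \in resf (M * level t) (lclass t x) ->
   \sum_(a <- lclass t x | h a == y) theta ^+ nbad T t a
   <= theta ^+ (nsub t x != M) * (M ^ j * m)%:R.
  move=> /resfP[b bx ->]; have bA : b \in A by move: bx; rewrite mem_lclass => /andP[].
  have theta0 : 0 <= theta by rewrite divr_ge0.
  apply: le_trans (ler_wpM2l (exprn_ge0 _ theta0) (IH (ltnW jT) b bA)).
  rewrite mulr_sumr big_fset_condE /=.
  rewrite [leRHS](big_fsetID _ (fun a => h a == h b)) /=.
  apply: ler_wpDr.
    by apply: sumr_ge0 => a _; rewrite mulr_ge0 // exprn_ge0.
  have -> : [fset a in lclass t.+1 b | h a == h b]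
      = [fset a in lclass t x | h a == h b].
    apply/fsetP => a; rewrite !inE /=; case: (boolP (a \in A)) => //= aA.
    rewrite eq_modz; case: (boolP (_ %| a - b)%Z) => hab; rewrite ?andbF // !andbT.
    rewrite level_congr //; apply/esym.
    have h1 : ((level t)%:Z %| a - b)%Z.
      by apply: dvdz_trans hab; rewrite PoszM dvdz_mull.
    have h2 : ((level t)%:Z %| b - x)%Z by move: bx; rewrite mem_lclass => /andP[].
    by have := rpredD h1 h2; rewrite addrA subrK.
  rewrite big_seq [leRHS]big_seq; apply: ler_sum => a.
  rewrite !inE /= => /andP[/andP[aA ax] _].
  rewrite -exprD /nbad big_ltn // /nsub (@lclass_eq t x a) //.
  by rewrite mem_lclass aA.
apply: le_trans (_ : \sum_(y <- resf (M * level t) (lclass t x))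
   theta ^+ (nsub t x != M) * (M ^ j * m)%:R <= _).
  by rewrite big_seq [leRHS]big_seq; apply: ler_sum.
rewrite big_const_seq count_predT iter_addr addr0 -/(nsub t x).
rewrite -[leLHS]mulr_natl mulrA expnS -(mulnA M) (natrM _ M) ler_wpM2r //.
have [->|ne] := eqVneq (nsub t x) M; first by rewrite mulr1.
have : (nsub t x <= M.-1)%N by have := nsub_le x lt; lia.
rewrite expr1 /theta mulrA ler_pdivrMr; last by rewrite ltr0n; lia.
by rewrite -natrM -natrM ler_nat mulnC leq_mul2l => ->; rewrite orbT.
Qed.

(** If a proportion 1/E of A were bad at each of the T levels, a proportion 1/(2E) would be bad at
    least q times. The weighted count then forces M^T times the largest class, hence an iterated
    sumset of D, above the polynomial bound. *)
Lemma exists_full_level (K E q : nat) (T := (2 * E * q)%N) :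
  (0 < E)%N -> (0 < q)%N ->
  (forall n, (#|` nsumf n.+1 D| <= n.+1 ^ (K ^ 5) * (K * #|` A|))%N) ->
  (M ^ T < #|` A|)%N ->
  (2 * E * K * (2 * E * (M * M) * q + 1) ^ (K ^ 5))%:R < theta ^+ q ->
  exists2 t, (t < T)%N & (E * #|` [fset a in A | nsub t a != M]| <= #|` A|)%N.
Proof.
move=> E0 q0 growth cA qP.
apply: contrapT => nex.
have bad t : (t < T)%N -> (#|` A| <= E * #|` [fset a in A | nsub t a != M]|)%N.
  move=> tT; rewrite leqNgt; apply/negP => /ltnW h; apply: nex; by exists t.
have lT := level_gt0_of_card cA.
have A_gt0 : (0 < #|` A|)%N by rewrite cardfs_gt0.
have [x xA xmax] := exists_argminf (fun a => - (#|` lclass T a|%:R : rat)) A0.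
have {}xmax a : a \in A -> (#|` lclass T a| <= #|` lclass T x|)%N.
  by move=> /xmax; rewrite lerN2 ler_nat.
have theta_sum := sum_theta_nbad lT xmax (leqnn T) xA.
rewrite subnn in theta_sum.
have clA : lclass 0 x = A.
  apply/fsetP => a; rewrite mem_lclass; case: (boolP (a \in A)) => //= aA.
  by rewrite level0_congr.
rewrite clA in theta_sum.
pose H := [fset a in A | (q <= nbad T 0 a)%N].
(* The levels at which elements are bad sum to at least 2 q |A|; elements outside H contribute less
   than q each, and those in H at most T = 2 E q each. *)
have cH : (#|` A| <= 2 * E * #|` H|)%N.
  have s1 : (2 * q * #|` A| <= \sum_(a <- A) nbad T 0 a)%N.
    rewrite -(leq_pmul2l E0) exchange_big /=.
    have -> : (E * (2 * q * #|` A|) = \sum_(0 <= t < T) #|` A|)%N.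
      by rewrite sum_nat_const_nat subn0 /T; ring.
    rewrite big_distrr /= big_nat [leqRHS]big_nat; apply: leq_sum => t /andP[_ tT].
    by rewrite -cardf_sumE bad.
  have s2 : (\sum_(a <- A) nbad T 0 a <= T * #|` H| + q * #|` A|)%N.
    rewrite cardf_sumE card_fset_sum1 !big_distrr -big_split /=.
    apply: leq_sum => a _; rewrite muln1; case: (leqP q (nbad T 0 a)) => h /=; last by rewrite muln0 add0n ltnW.
    rewrite muln1 (leq_trans _ (leq_addr _ _)) //.
    rewrite /nbad; apply: (@leq_trans (\sum_(0 <= s < T) 1)%N).
      by apply: leq_sum => s _; apply: leq_b1.
    by rewrite sum_nat_const_nat subn0 muln1.
  have := leq_trans s1 s2; rewrite /T => h.
  rewrite -(leq_pmul2l q0).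
  have -> : (q * (2 * E * #|` H|) = 2 * E * q * #|` H|)%N by ring.
  rewrite -(leq_add2r (q * #|` A|)); apply: leq_trans h.
  by rewrite leq_eqVlt; apply/orP; left; apply/eqP; ring.
have theta1 : 1 <= theta.
  by rewrite ler_pdivlMr ?mul1r ?ler_nat ?ltr0n; lia.
have h1 : theta ^+ q * #|` H|%:R <= (M ^ T * #|` lclass T x|)%:R.
  apply: le_trans theta_sum.
  have -> : #|` H|%:R = \sum_(a <- H) 1 :> rat.
    by rewrite big_const_seq count_predT iter_addr addr0.
  rewrite mulr_sumr -big_fset_condE /= [leRHS](bigID (fun a => q <= nbad T 0 a)%N) /=.
  apply: ler_wpDr; last first.
    by apply: ler_sum => a h; rewrite mulr1 ler_weXn2l.
  by apply: sumr_ge0 => a _; rewrite exprn_ge0 // (le_trans _ theta1).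
(* Translation by -x moves A into D, which accounts for the one extra summand. *)
have h2 : (M ^ T * #|` lclass T x|
     <= (T * (M * M)).+1 ^ (K ^ 5) * (K * #|` A|))%N.
  apply: leq_trans (growth _); apply: leq_trans (card_lclass_growth x lT) _.
  apply: (leq_cardf_inj (f := fun y => y - x)); last by move=> ? ? _ _ /addIr.
  move=> _ /addfP[a aA [b bD ->]]; rewrite addrAC; apply: mem_addf => //.
  exact: mem_diff.
have h3 : theta ^+ q * #|` A|%:R <=
    (2 * E * ((T * (M * M)).+1 ^ (K ^ 5) * (K * #|` A|)))%:R.
  apply: (@le_trans _ _ (theta ^+ q * (2 * E * #|` H|)%:R)).
    by rewrite ler_wpM2l ?ler_nat // exprn_ge0 // (le_trans _ theta1).
  rewrite natrM mulrCA [leRHS]natrM ler_wpM2l //.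
  by apply: (le_trans h1); rewrite ler_nat.
have : theta ^+ q <= (2 * E * ((T * (M * M)).+1 ^ (K ^ 5) * K))%:R.
  rewrite -(ler_pM2r (_ : 0 < #|` A|%:R)) ?ltr0n //; apply: (le_trans h3).
  by rewrite -natrM ler_nat !mulnA.
move=> /(lt_le_trans qP); rewrite ltr_nat.
suff -> : (2 * E * K * (2 * E * (M * M) * q + 1) ^ K ^ 5
  = 2 * E * ((T * (M * M)).+1 ^ K ^ 5 * K))%N by rewrite ltnn.
have -> : ((T * (M * M)).+1 = 2 * E * (M * M) * q + 1)%N by rewrite /T addn1; congr S; ring.
by rewrite -!mulnA (mulnC K).
Qed.

End Levels.

(** * The asymptotic bound over the integers *)

(** Dividing by E leaves an error (L |A| + C) / E; with E arbitrary this is a little-o estimate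
    written in natural numbers. *)
Lemma card_sumdil_int_asymptotic (I : eqType) (r : seq I) (l : I -> int)
    (E : nat) (L := (\sum_(i <- r) `|l i|)%N) :
  uniq r -> (1 < size r)%N -> {in r, forall i, l i != 0} ->
  \big[gcdz/0]_(i <- r) l i = 1 -> (0 < E)%N ->
  exists C : nat, forall A : {fset int},
    (E * (L * #|` A|) <= E * #|` sumdil r l (fun=> A)| + L * #|` A| + C)%N.
Proof.
move=> ur sr l0 g1 E0.
(* The factor 2 keeps M above 1 when every coefficient is 1 or -1. *)
pose M := (2 * \prod_(i <- r) `|l i|)%N; pose K := (L ^ 2)%N.
have prod_gt0 : (0 < \prod_(i <- r) `|l i|)%N.
  by rewrite big_seq prodn_cond_gt0 // => i ir; rewrite absz_gt0 l0.
have M1 : (1 < M)%N by rewrite /M; lia.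
have M0 : (0 < M)%N by apply: ltnW.
have lM : {in r, forall i, (`|l i| %| M)%N}.
  by move=> i ir; apply: dvdn_mull; rewrite (big_rem i ir) /= dvdn_mulr.
have theta1 : 1 < M%:R / M.-1%:R :> rat.
  by rewrite ltr_pdivlMr ?mul1r ?ltr_nat ?ltr0n; lia.
(* q, and with it the number T of levels, depends only on the coefficients and E, so the constant is
   uniform in A. *)
have [q q0 qP] := exp_beats_poly (2 * E * (M * M)) (2 * E * K) (K ^ 5) theta1.
pose T := (2 * E * q)%N.
pose C1 := (E * (L * M ^ T))%N.
pose C2 := ((M ^ T) ^ size r * (size r * M))%N.
exists (C1 + E * C2)%N => A.
have [cA|cA] := leqP #|` A| (M ^ T).
  have : (E * (L * #|` A|) <= C1)%N by rewrite !leq_mul2l cA !orbT.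
  by move=> h; apply: (leq_trans h); rewrite addnCA leq_addr.
have A0 : A != fset0 by rewrite -cardfs_gt0; apply: leq_ltn_trans cA.
have [small|big] := leqP #|` sumdil r l (fun=> A)| (L * #|` A|); last first.
  apply: (@leq_trans (E * #|` sumdil r l (fun=> A)|)).
    by rewrite leq_mul2l ltnW ?orbT.
  by rewrite -addnA leq_addr.
have linj : {in r, forall i, injective (fun x : int => x *~ l i)}.
  by move=> i ir; apply/mulrz_int_inj/l0.
have dK := small_difference_set sr A0 linj small.
have growth := polynomial_growth A0 dK.
have [t tT bad] := exists_full_level M1 A0 E0 q0 growth cA qP.
have lt : (0 < level A M t)%N by apply: level_gt0 (level_gt0_of_card M1 cA); apply: ltnW.
(* [nsub] is constant on a class, so B is a union of classes, each meeting all its M subclasses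
   inside B. *)
pose B := [fset a in A | nsub A M t a == M].
have sBA : B `<=` A by apply/fsubsetP => a; rewrite !inE => /andP[].
have cB : #|` A| = (#|` B| + #|` [fset a in A | nsub A M t a != M]|)%N.
  rewrite !cardf_sumE -big_split /= card_fset_sum1; apply: eq_bigr => a _.
  by case: eqP.
have Bfull a : a \in B -> forall z : int, exists2 b, b \in B &
    ((level A M t)%:Z * M%:Z %| b - a - (level A M t)%:Z * z)%Z.
  rewrite !inE /= => /andP[aA /eqP na] z.
  have [b bC hb] := nsub_full M1 A0 lt na z; exists b => //.
  have bA : b \in A by move: bC; rewrite mem_lclass => /andP[].
  by rewrite !inE /= bA /nsub (lclass_eq bC) -/(nsub A M t a) na eqxx.
have := card_sumdil_full ur lt M0 l0 lM g1 Bfull; rewrite -/L => fullB.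
have cC : (#|` resf (level A M t) B| ^ size r * (size r * M) <= C2)%N.
  rewrite leq_mul2r; apply/orP; right; rewrite leq_exp2r; last exact: ltnW.
  apply: leq_trans (fsubset_leq_card (resfS _ sBA)) _.
  apply: leq_trans; first by apply: card_resf_level.
  by rewrite leq_exp2l // ltnW.
have sS : (#|` sumdil r l (fun=> B)| <= #|` sumdil r l (fun=> A)|)%N.
  by apply/fsubset_leq_card/sumdilS => i _.
have LB : (L * #|` B| <= #|` sumdil r l (fun=> A)| + C2)%N.
  by apply: (leq_trans fullB); apply: leq_add.
move: bad LB cB; set b := #|` B|; set n := #|` A|.
set S := #|` sumdil r l _|; set w := #|` _| => bad LB cB.
clear -bad LB cB.
have : (L * (E * w) <= L * n)%N by rewrite leq_mul2l bad orbT.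
have : (E * (L * b) <= E * (S + C2))%N by rewrite leq_mul2l LB orbT.
rewrite {1}cB; nia.
Qed.

(** * Fourier analysis and rectification modulo p *)

Section Characters.
Variables (R : realType) (p : nat).
Hypothesis pr_p : prime p.
Local Notation F := 'F_p.

Definition ang (n : nat) : R := pi *+ 2 * (n%:R / p%:R).
(** [cs] and [sn] are the real and imaginary parts of the additive character exp(2 pi i x / p). *)
Definition cs (x : F) : R := cos (ang x).
Definition sn (x : F) : R := sin (ang x).

Let p_neq0 : p%:R != 0 :> R.
Proof. by rewrite pnatr_eq0 -lt0n prime_gt0. Qed.

Lemma angD m n : ang (m + n) = ang m + ang n.
Proof. by rewrite /ang natrD (mulrDl m%:R) mulrDr. Qed.

Lemma ang_mulp k : ang (k * p) = (pi *+ 2) *+ k.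
Proof. by rewrite /ang natrM mulfK // mulr_natr. Qed.

Lemma ang_mod n : cos (ang (n %% p)) = cos (ang n) /\ sin (ang (n %% p)) = sin (ang n).
Proof.
rewrite {2 4}(divn_eq n p) addnC angD ang_mulp; split.
  by rewrite (periodicn (@cosD2pi R)).
by rewrite (periodicn (@sinD2pi R)).
Qed.

Lemma val_FpD (x y : F) : (x + y : F) = ((x + y) %% p)%N :> nat.
Proof. by rewrite /=; congr (_ %% _)%N; apply: Fp_cast. Qed.

Lemma csD x y : cs (x + y) = cs x * cs y - sn x * sn y.
Proof. by rewrite /cs val_FpD (ang_mod _).1 angD cosD. Qed.

Lemma snD x y : sn (x + y) = sn x * cs y + cs x * sn y.
Proof. by rewrite /sn val_FpD (ang_mod _).2 angD sinD. Qed.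

Lemma cs0 : cs 0 = 1.
Proof. by rewrite /cs /ang /= mul0r mulr0 cos0. Qed.

Lemma sn0 : sn 0 = 0.
Proof. by rewrite /sn /ang /= mul0r mulr0 sin0. Qed.

Lemma cs2Dsn2 x : cs x ^+ 2 + sn x ^+ 2 = 1.
Proof. exact: cos2Dsin2. Qed.

Lemma csB x y : cs (x - y) = cs x * cs y + sn x * sn y.
Proof.
have e1 := csD (x - y) y; have e2 := snD (x - y) y; rewrite !subrK in e1 e2.
rewrite e1 e2 -[LHS]mulr1 -(cs2Dsn2 y); ring.
Qed.

Lemma cs1_lt1 : cs 1 < 1.
Proof.
have p1 := prime_gt1 pr_p.
have v1 : nat_of_ord (1 : F) = 1%N by [].
have pp : (0 : R) < p%:R by rewrite ltr0n prime_gt0.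
have tp : (0 : R) < pi *+ 2 by rewrite pmulrn_lgt0 // pi_gt0.
have a0 : 0 < ang 1 by rewrite /ang mulr_gt0 // divr_gt0.
rewrite /cs v1 -cos0 ltr_cos // ?in_itv /= ?lexx ?pi_ge0 // (ltW a0) /=.
rewrite /ang mulrA mulr1 ler_pdivrMr // -(mulr_natr pi) ler_wpM2l ?pi_ge0 //.
by rewrite ler_nat.
Qed.

Lemma sum_cs_mul (x : F) : \sum_(t : F) cs (t * x) = (x == 0)%:R * p%:R.
Proof.
have [->|x0] := eqVneq x 0.
  under eq_bigr => t _ do rewrite mulr0 cs0.
  by rewrite sumr_const card_Fp // mul1r.
have xinj : injective (fun t : F => t * x) by move=> a b /(mulIf x0).
rewrite mul0r -(reindex_inj xinj (P := predT) (F := fun t => cs t)) /=.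
(* The shift t -> t + 1 permutes the terms and rotates the vector (C, S) by the angle 2 pi / p; a
   vector fixed by a nontrivial rotation is zero. *)
set C := \sum_t cs t; pose S := \sum_(t : F) sn t.
have eC : C = C * cs 1 - S * sn 1.
  rewrite {1}/C (reindex_inj (addIr (1 : F))) /=.
  by under eq_bigr => t _ do rewrite csD; rewrite sumrB !mulr_suml.
have eS : S = S * cs 1 + C * sn 1.
  rewrite {1}/S (reindex_inj (addIr (1 : F))) /=.
  by under eq_bigr => t _ do rewrite snD; rewrite big_split /= !mulr_suml.
have e2 := cs2Dsn2 1; have lt1 := cs1_lt1.
have : C * (1 - cs 1) = 0.
  have : C * ((1 - cs 1) ^+ 2 + sn 1 ^+ 2) = 0.
    have -> : C * ((1 - cs 1) ^+ 2 + sn 1 ^+ 2) =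
      (C - (C * cs 1 - S * sn 1)) * (1 - cs 1)
      - sn 1 * (S - (S * cs 1 + C * sn 1)) by ring.
    by rewrite -eC -eS !subrr mul0r mulr0 subr0.
  have -> : (1 - cs 1) ^+ 2 + sn 1 ^+ 2 = 2 * (1 - cs 1).
    transitivity (cs 1 ^+ 2 + sn 1 ^+ 2 + 1 - 2 * cs 1); first by ring.
    by rewrite e2; ring.
  by rewrite mulrCA => /eqP; rewrite mulf_eq0 pnatr_eq0 /= => /eqP.
by move=> /eqP; rewrite mulf_eq0 subr_eq0 [1 == _]gt_eqF // orbF => /eqP.
Qed.

(* Squared modulus of the Fourier coefficient of f at the frequency t. *)
Definition pow_spec (f : F -> R) (t : F) : R :=
  (\sum_x f x * cs (t * x)) ^+ 2 + (\sum_x f x * sn (t * x)) ^+ 2.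

Lemma pow_specE f t :
  pow_spec f t = \sum_x \sum_y f x * f y * cs (t * (x - y)).
Proof.
rewrite /pow_spec !expr2 !mulr_suml -big_split /=; apply: eq_bigr => x _.
rewrite !mulr_sumr -big_split /=; apply: eq_bigr => y _.
by rewrite mulrBr csB; ring.
Qed.

Lemma parseval f : \sum_(t : F) pow_spec f t = p%:R * \sum_x f x ^+ 2.
Proof.
under eq_bigr => t _ do rewrite pow_specE.
rewrite exchange_big /= mulr_sumr; apply: eq_bigr => x _.
rewrite exchange_big /= (bigD1 x) //= [X in _ + X]big1 ?addr0.
  by rewrite -mulr_sumr sum_cs_mul subrr eqxx mul1r; ring.
move=> y yx; rewrite -mulr_sumr sum_cs_mul subr_eq0 eq_sym (negPf yx).
by rewrite mul0r mulr0.
Qed.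

Definition indf (A : {fset F}) (x : F) : R := (x \in A)%:R.

Lemma sum_indf (A : {fset F}) (f : F -> R) : \sum_x indf A x * f x = \sum_(a <- A) f a.
Proof.
rewrite /indf; under eq_bigr => x _ do rewrite mulr_natl mulrb.
rewrite -big_mkcond /= [RHS]big_uniq ?fset_uniq //.
Qed.

Lemma sum_indf1 (A : {fset F}) : \sum_x indf A x = #|` A|%:R.
Proof.
under eq_bigr => x _ do rewrite -[indf A x]mulr1.
by rewrite sum_indf big_const_seq count_predT iter_addr addr0.
Qed.

Lemma indf_sqr A x : indf A x ^+ 2 = indf A x.
Proof. by rewrite /indf; case: (_ \in _); rewrite ?expr1n ?expr0n. Qed.

Lemma cauchy_schwarz_support (X : {fset F}) (f : F -> R) :
  (forall x, x \notin X -> f x = 0) ->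
  (\sum_x f x) ^+ 2 <= #|` X|%:R * \sum_x f x ^+ 2.
Proof.
move=> fX.
have cf x : indf X x * f x = f x.
  by rewrite /indf; case: (boolP (x \in X)) => [_|/fX ->]; rewrite ?mul1r ?mulr0.
set S := \sum_x f x; set Q := \sum_x f x ^+ 2; set N := #|` X|%:R.
have [X0|X0] := eqVneq X fset0.
  have -> : S = 0 by rewrite /S big1 // => x _; rewrite fX // X0.
  by rewrite expr0n /= mulr_ge0 // sumr_ge0 // => x _; rewrite sqr_ge0.
have N0 : 0 < N by rewrite ltr0n cardfs_gt0.
have : 0 <= \sum_x (N * f x - S * indf X x) ^+ 2.
  by apply: sumr_ge0 => x _; rewrite sqr_ge0.
have -> : \sum_x (N * f x - S * indf X x) ^+ 2 = N * (N * Q - S ^+ 2).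
  transitivity (\sum_x (N ^+ 2 * f x ^+ 2 - 2 * N * S * f x + S ^+ 2 * indf X x)).
    apply: eq_bigr => x _; transitivity (N ^+ 2 * f x ^+ 2
      - 2 * N * S * (indf X x * f x) + S ^+ 2 * indf X x ^+ 2); first by ring.
    by rewrite cf indf_sqr.
  rewrite big_split /= sumrB -!mulr_sumr sum_indf1 -/S -/Q -/N; ring.
by rewrite pmulr_rge0 // subr_ge0.
Qed.

Variable A : {fset F}.
Local Notation indA := (indf A).

(** The number of ordered representations of x as a sum of n elements of A, that is, the n-fold
    convolution power of the indicator function. *)
Fixpoint nreps n (x : F) : R :=
  if n is n'.+1 then \sum_(a <- A) nreps n' (x - a) else (x == 0)%:R.

Lemma nreps_support n x : x \notin nsumf n A -> nreps n x = 0.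
Proof.
elim: n x => [|n IH] x /=; first by rewrite inE => /negPf ->.
move=> xn; rewrite big_seq big1 // => a aA; apply: IH.
apply: contra xn => xa; rewrite -(subrK a x) addrC; exact: mem_addf.
Qed.

Lemma sum_nreps n : \sum_x nreps n x = #|` A|%:R ^+ n.
Proof.
elim: n => [|n IH] /=.
  rewrite expr0 (bigD1 (0 : F)) //= ?eqxx big1 ?addr0 // => x /negPf ->.
  by [].
rewrite exchange_big /= exprS -IH.
under eq_bigr => a _ do rewrite -(reindex_inj (addIr (- a)) (P := predT) (F := nreps n)) /=.
by rewrite big_const_seq count_predT iter_addr addr0 mulr_natl.
Qed.

(** Convolution multiplies Fourier coefficients; the induction step computes the real and imaginary
    parts of that product. *)
Lemma pow_spec_nreps n t : pow_spec (nreps n) t = pow_spec indA t ^+ n.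
Proof.
elim: n => [|n IH].
  rewrite expr0 /pow_spec /= (bigD1 (0 : F)) //= [X in _ + X ^+ 2](bigD1 (0 : F)) //=.
  rewrite !big1; try by move=> x /negPf ->; rewrite mul0r.
  by rewrite ?eqxx mulr0 cs0 sn0 mul1r mulr0 !addr0 expr1n expr0n addr0.
rewrite exprS -IH {2 3}/pow_spec /= !sum_indf.
rewrite /pow_spec /=.
set CA := \sum_(a <- A) cs (t * a); set SA := \sum_(a <- A) sn (t * a).
set Cn := \sum_x nreps n x * cs (t * x); set Sn := \sum_x nreps n x * sn (t * x).
have -> : \sum_x (\sum_(a <- A) nreps n (x - a)) * cs (t * x) = Cn * CA - Sn * SA.
  under eq_bigr => x _ do rewrite mulr_suml.
  rewrite exchange_big /= !mulr_sumr -sumrB; apply: eq_bigr => a _.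
  rewrite (reindex_inj (addIr a)) /= !mulr_suml -sumrB; apply: eq_bigr => x _.
  by rewrite addrK mulrDr csD; ring.
have -> : \sum_x (\sum_(a <- A) nreps n (x - a)) * sn (t * x) = Sn * CA + Cn * SA.
  under eq_bigr => x _ do rewrite mulr_suml.
  rewrite exchange_big /= !mulr_sumr -big_split /=; apply: eq_bigr => a _.
  rewrite (reindex_inj (addIr a)) /= !mulr_suml -big_split /=; apply: eq_bigr => x _.
  by rewrite addrK mulrDr snD; ring.
ring.
Qed.

Lemma pow_spec_ge0 f t : 0 <= pow_spec f t.
Proof. by rewrite /pow_spec addr_ge0 // sqr_ge0. Qed.

(* If all nonzero frequencies were far from the maximum, the L^2 mass of the
   representation function of the (n+1)-fold sumset would be spread out and
   that sumset would be large. *)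
Lemma growth_of_small_spectrum n (g : nat) (rho : R) : A != fset0 -> 0 <= rho ->
  (#|` nsumf n.+1 A| <= g * #|` A|)%N ->
  (forall t, t != 0 -> pow_spec indA t <= rho * #|` A|%:R ^+ 2) ->
  p%:R <= g%:R * (#|` A|%:R + rho ^+ n * p%:R).
Proof.
move=> A0 rho0 hg spec; set a := #|` A|%:R : R.
have a0 : 0 < a by rewrite ltr0n cardfs_gt0.
have sumP : \sum_t pow_spec indA t = p%:R * a.
  rewrite parseval; congr (_ * _).
  by under eq_bigr => x _ do rewrite indf_sqr; rewrite sum_indf1.
have P0 : pow_spec indA 0 = a ^+ 2.
  rewrite /pow_spec; under eq_bigr => x _ do rewrite mul0r cs0 mulr1.
  under [X in _ + X ^+ 2]eq_bigr => x _ do rewrite mul0r sn0 mulr0.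
  by rewrite sum_indf1 big1_eq expr0n addr0.
(* Frequency 0 contributes the first term. Elsewhere n of the n + 1 factors are bounded by the
   hypothesis, and Parseval sums the remaining one. *)
have moment : \sum_t pow_spec indA t ^+ n.+1 <=
    a ^+ (2 * n.+1) + (rho * a ^+ 2) ^+ n * (p%:R * a).
  rewrite (bigD1 (0 : F)) //= P0 -exprM lerD2l.
  apply: (@le_trans _ _ (\sum_(t | t != 0) (rho * a ^+ 2) ^+ n * pow_spec indA t)).
    apply: ler_sum => t t0; rewrite exprSr ler_wpM2r ?pow_spec_ge0 //.
    by rewrite lerXn2r ?nnegrE ?pow_spec_ge0 ?spec // mulr_ge0 // exprn_ge0 // ltW.
  have ge0 : 0 <= (rho * a ^+ 2) ^+ n by rewrite exprn_ge0 // mulr_ge0 // sqr_ge0.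
  rewrite -mulr_sumr ler_wpM2l //.
  by rewrite -sumP [leRHS](bigD1 (0 : F)) //= lerDr pow_spec_ge0.
have cs := cauchy_schwarz_support (@nreps_support n.+1).
rewrite sum_nreps -/a -exprM in cs.
have pe : p%:R * \sum_x nreps n.+1 x ^+ 2 = \sum_t pow_spec indA t ^+ n.+1.
  by rewrite -parseval; apply: eq_bigr => t _; rewrite pow_spec_nreps.
have pp : 0 <= p%:R :> R by [].
have h1 := ler_wpM2l pp cs; rewrite [leRHS]mulrCA pe in h1.
have h2 : #|` nsumf n.+1 A|%:R <= g%:R * a :> R by rewrite -natrM ler_nat.
have h3 : p%:R * a ^+ (n.+1 * 2) <=
    g%:R * a * (a ^+ (2 * n.+1) + (rho * a ^+ 2) ^+ n * (p%:R * a)).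
  apply: (le_trans h1).
  apply: (@le_trans _ _ (g%:R * a * \sum_t pow_spec indA t ^+ n.+1)).
    by rewrite ler_wpM2r // sumr_ge0 // => t _; rewrite exprn_ge0 ?pow_spec_ge0.
  by rewrite ler_wpM2l // mulr_ge0 // ltW.
have e : g%:R * a * (a ^+ (2 * n.+1) + (rho * a ^+ 2) ^+ n * (p%:R * a))
   = g%:R * (a + rho ^+ n * p%:R) * a ^+ (n.+1 * 2).
  have -> : (n.+1 * 2 = (n * 2).+2)%N by rewrite mulSn.
  have -> : (2 * n.+1 = (n * 2).+2)%N by rewrite mulnC mulSn.
  rewrite exprMn -exprM (mulnC 2%N) !exprS; ring.
by move: h3; rewrite e ler_pM2r // exprn_gt0.
Qed.

(** The arc of radius [b] around 0 in the cyclic group. *)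
Definition nearF (b : nat) (x : F) := ((x <= b) || (p - x <= b))%N.

Lemma cs_far (N : nat) (x : F) : (1 < N)%N -> ~~ nearF (p %/ N) x ->
  cs x <= cos (pi *+ 2 / N%:R).
Proof.
move=> N1; rewrite negb_or -!ltnNge => /andP[h1 h2].
have N0 : (0 < N)%N by apply: ltnW.
have pp : (0 < p)%N by apply: prime_gt0.
have xp : (x < p)%N by have := ltn_ord x; rewrite {2}Fp_cast.
have pi0 : (0 : R) < pi *+ 2 by rewrite pmulrn_lgt0 // pi_gt0.
have key (v : nat) : (p %/ N < v)%N -> (2 * v <= p)%N ->
    cos (ang v) <= cos (pi *+ 2 / N%:R).
  move=> vN v2; rewrite leNgt ltr_cos ?in_itv /=.
  - rewrite -leNgt /ang ler_pM2l // ler_pdivlMr ?ltr0n // ler_pdivrMl ?ltr0n //.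
    rewrite -natrM ler_nat ltnW // mulnC; move: vN.
    by rewrite ltn_divLR.
  - apply/andP; split; first by rewrite /ang mulr_ge0 ?divr_ge0 // ltW.
    rewrite /ang -(mulr_natr pi) -mulrA ler_piMr ?pi_ge0 //.
    by rewrite mulrA ler_pdivrMr ?ltr0n // mul1r -natrM ler_nat.
  - apply/andP; split; first by rewrite divr_ge0 // ltW.
    by rewrite ler_pdivrMr ?ltr0n // -(mulr_natr pi) ler_wpM2l ?pi_ge0 // ler_nat.
have [le|gt] := leqP (2 * x) p; first by apply: key.
have -> : cs x = cos (ang (p - x)).
  rewrite /cs -cosN -(cosD2pi (- ang x)); congr cos.
  rewrite addrC; apply/eqP; rewrite subr_eq -angD subnK 1?ltnW //.
  by rewrite -[X in ang X](mul1n p) ang_mulp mulr1n.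
by apply: key => //; lia.
Qed.

(** The squared coefficient is the sum of cs (t (b - x)) over b and x in A. If every b had fewer
    than half of A nearby, each inner sum would be at most the mean of 1 and cos (2 pi / N), times
    |A|. *)
Lemma concentration (N : nat) (t : F) : (1 < N)%N -> A != fset0 ->
  (1 - (1 - cos (pi *+ 2 / N%:R)) / 2) * #|` A|%:R ^+ 2 < pow_spec indA t ->
  exists2 b, b \in A &
    (#|` A| <= 2 * #|` [fset a in A | nearF (p %/ N) (t * (b - a))%R]|)%N.
Proof.
move=> N1 A0; set c := cos _; set a := #|` A|%:R; rewrite ltNge => /negP spec.
apply: contrapT => nex; apply: spec.
have c1 : c <= 1 by apply: cos_le1.
rewrite pow_specE.
under eq_bigr => x _ do under eq_bigr => y _ do rewrite -mulrA.
under eq_bigr => x _ do rewrite -mulr_sumr sum_indf.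
rewrite sum_indf.
apply: (@le_trans _ _ (\sum_(b <- A) (1 - (1 - c) / 2) * a)); last first.
  by rewrite big_const_seq count_predT iter_addr addr0 -[leLHS]mulr_natr -/a -mulrA -expr2.
rewrite big_seq [leRHS]big_seq; apply: ler_sum => b bA.
pose Y := [fset a in A | nearF (p %/ N) (t * (b - a))].
have hY : (2 * #|` Y| <= #|` A|)%N.
  rewrite leqNgt; apply/negP => /ltnW h; apply: nex; by exists b.
apply: (@le_trans _ _ (\sum_(x <- A) (c + (1 - c) * (nearF (p %/ N) (t * (b - x)))%:R))).
  apply: ler_sum => x _.
  have [_|far] := boolP (nearF _ _); first by rewrite mulr1 subrKC; apply: cos_le1.
  by rewrite mulr0 addr0; apply: cs_far.
rewrite big_split /= -mulr_sumr -natr_sum -cardf_sumE -/Y.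
rewrite big_const_seq count_predT iter_addr addr0 -[X in X + _]mulr_natr -/a.
have : 2 * #|` Y|%:R <= a by rewrite -natrM ler_nat.
by nra.
Qed.

End Characters.

(** * Dirichlet approximation and rectification *)

Section Rectification.
Variable p : nat.
Hypothesis pr_p : prime p.
Local Notation F := 'F_p.

(** Any integer representative is allowed, so bounds add under sums and scale under multiples
    without wrap-around. *)
Definition smallF (b : nat) (x : F) := exists2 z : int, (`|z| <= b)%N & x = z%:~R.

Lemma ltn_Fp (x : F) : (x < p)%N.
Proof. by have := ltn_ord x; rewrite {2}Fp_cast. Qed.

Lemma natr_Fp (x : F) : (nat_of_ord x)%:R = x.
Proof. exact: natr_Zp. Qed.

Lemma Fp_intr_eq0 (z : int) : (z%:~R == 0 :> F) = (p%:Z %| z)%Z.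
Proof. by rewrite (dvdz_pcharf (pchar_Fp pr_p)). Qed.

Lemma near_smallF b x : nearF b x -> smallF b x.
Proof.
case/orP => h; first by exists (nat_of_ord x)%:Z; rewrite // -pmulrn natr_Fp.
exists (- (p - x)%N%:Z); first by rewrite abszN.
rewrite mulrNz -pmulrn natrB 1?ltnW ?ltn_Fp // natr_Fp.
by rewrite pchar_Fp_0 // sub0r opprK.
Qed.

Lemma smallFD b c x y : smallF b x -> smallF c y -> smallF (b + c) (x + y).
Proof.
move=> [z zb ->] [w wc ->]; exists (z + w); last by rewrite intrD.
by apply: leq_trans (leq_add zb wc); clear; lia.
Qed.

Lemma smallFN b x : smallF b x -> smallF b (- x).
Proof. by move=> [z zb ->]; exists (- z); rewrite ?abszN // mulrNz. Qed.

Lemma smallFM b x (n : nat) : smallF b x -> smallF (n * b) (n%:R * x).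
Proof.
move=> [z zb ->]; exists (n%:Z * z); last by rewrite intrM -pmulrn.
by rewrite abszM leq_mul2l zb orbT.
Qed.

(** Pigeonhole on Q^|S| + 1 multiples of x and Q^|S| boxes: tau is the difference of two multipliers
    sharing a box. *)
Lemma dirichlet (Q : nat) (S : {fset F}) (x : F) : (0 < Q)%N -> exists tau : nat,
  (0 < tau <= Q ^ #|` S|)%N /\
  {in S, forall s, smallF (p %/ Q) (tau%:R * (x * s))}.
Proof.
move=> Q0; case: Q Q0 => // Q _; have p0 := prime_gt0 pr_p.
pose v (i : nat) (s : F) : nat := nat_of_ord (i%:R * (x * s) : F).
pose f (i : 'I_(Q.+1 ^ #|` S|).+1) : {ffun S -> 'I_Q.+1} :=
  [ffun s => inord ((Q.+1 * v i (val s)) %/ p)].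
have : ~~ injectiveb f.
  apply/injectiveP => /leq_card; rewrite card_ffun !card_ord -cardfE.
  by rewrite ltnn.
move=> /injectivePn[i [j ij fij]].
wlog lt_ij : i j ij fij / (i < j)%N.
  move=> H; have [lt|gt|e] := ltngtP i j; first exact: (H i j).
    by apply: (H j i) => //; rewrite eq_sym.
  by rewrite (val_inj e) eqxx in ij.
exists (j - i)%N; split.
  by rewrite subn_gt0 lt_ij /= (leq_trans (leq_subr _ _)) // -ltnS ltn_ord.
move=> s sS; exists ((v j s)%:Z - (v i s)%:Z); last first.
  by rewrite intrB -!pmulrn !natr_Fp natrB 1?ltnW // mulrBl.
have := congr1 (fun h : {ffun S -> 'I_Q.+1} => nat_of_ord (h [` sS])) fij.
have bnd k : ((Q.+1 * v k s) %/ p < Q.+1)%N.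
  by rewrite ltn_divLR // ltn_pmul2l // ltn_Fp.
rewrite !ffunE /= !inordK // => e.
have ei := divn_eq (Q.+1 * v i s) p; have ej := divn_eq (Q.+1 * v j s) p.
have mi := ltn_pmod (Q.+1 * v i s) p0; have mj := ltn_pmod (Q.+1 * v j s) p0.
rewrite leq_divRL //.
have -> : (`|(v j s)%:Z - (v i s)%:Z| * Q.+1
    = `|(Q.+1 * v j s)%N%:Z - (Q.+1 * v i s)%N%:Z|)%N.
  by rewrite !PoszM -mulrBr abszM mulnC.
rewrite ei ej e; move: mi mj; clear; lia.
Qed.

End Rectification.

Lemma rectification (R : realType) (K Q : nat) : (0 < Q)%N ->
  exists2 alpha : R, 0 < alpha & forall p, prime p -> (Q ^ (2 * K) < p)%N ->
    forall A : {fset 'F_p}, A != fset0 ->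
    (#|` addf A (oppf A)| <= K * #|` A|)%N -> #|` A|%:R <= alpha * p%:R ->
    exists2 t : 'F_p, t != 0 & forall a, a \in A ->
      exists2 z : int, (`|z| * Q <= 2 * p)%N & t * a = z%:~R.
Proof.
(* N absorbs the later multiplication by tau, at most Q^(2K): two arcs of radius p / N scaled by tau
   together reach at most p / Q. *)
move=> Q0; pose N := (2 * Q ^ (2 * K).+1)%N.
have N1 : (1 < N)%N.
  have : (0 < Q ^ (2 * K).+1)%N by rewrite expn_gt0 Q0.
  by rewrite /N; lia.
pose eta : R := 1 - cos (pi *+ 2 / N%:R).
have N0 : (0 : R) < N%:R by rewrite ltr0n ltnW.
have pi0 : (0 : R) < pi *+ 2 by rewrite pmulrn_lgt0 // pi_gt0.
have eta0 : 0 < eta.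
  have y0 : (0 : R) < pi *+ 2 / N%:R by rewrite divr_gt0.
  have ypi : pi *+ 2 / N%:R <= pi :> R.
    by rewrite ler_pdivrMr // -(mulr_natr pi) ler_wpM2l ?pi_ge0 // ler_nat.
  have : cos (pi *+ 2 / N%:R) < cos 0 :> R.
    by rewrite ltr_cos // in_itv /= ?lexx ?pi_ge0 ?(ltW y0).
  by rewrite cos0 subr_gt0.
have eta2 : eta <= 2 by rewrite /eta; have := cos_geN1 (pi *+ 2 / N%:R : R); lra.
(* Only half of the loss eta / 2 is used: [rho] stays positive even if eta = 2, and still dominates
   the threshold 1 - eta / 2 of [concentration]. *)
pose rho : R := 1 - eta / 2 / 2.
have rho0 : 0 < rho by rewrite /rho; lra.
have rho1 : 1 < rho^-1 by rewrite invf_gt1 // /rho; lra.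
have [n _ nP] := exp_beats_poly 1 (2 * K) (K ^ 5) rho1.
rewrite mul1n addn1 exprVn in nP.
have [g gdef] : exists g, g = (n.+1 ^ (K ^ 5) * K)%N by eexists.
have rhon : 0 < rho ^+ n by rewrite exprn_gt0.
have gP : g%:R * rho ^+ n < 1 / 2 :> R.
  have gE : (2 * K * n.+1 ^ K ^ 5 = 2 * g)%N by rewrite gdef; ring.
  move: nP; rewrite gE -(ltr_pM2r rhon) mulVf ?gt_eqF // natrM -mulrA.
  by rewrite ltr_pdivlMr // mulrC.
(* This makes g |A| < p / 2, while g rho^n p is at most p / 2: together they contradict the lower
   bound of [growth_of_small_spectrum]. *)
exists (1 / (2 * g + 1)%:R) => [|p pr_p pQ A A0 dK cA].
  by rewrite divr_gt0 // ltr0n; lia.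
have p0 : (0 : R) < p%:R by rewrite ltr0n prime_gt0.
have [r r0 hr] : exists2 r : 'F_p, r != 0 &
    (1 - eta / 2) * #|` A|%:R ^+ 2 < pow_spec (indf R A) r.
  apply: contrapT => nex.
  have spec t : t != 0 -> pow_spec (indf R A) t <= rho * #|` A|%:R ^+ 2.
    move=> t0; rewrite leNgt; apply/negP => h; apply: nex; exists t => //.
    apply: le_lt_trans h; rewrite ler_wpM2r ?sqr_ge0 // /rho; lra.
  have hg : (#|` nsumf n.+1 A| <= g * #|` A|)%N.
    rewrite gdef -mulnA; apply: leq_trans (polynomial_growth A0 dK n).
    have /fset0Pn[a aA] := A0.
    apply: (leq_cardf_inj (f := fun y => y - a *+ n.+1)).
      elim: (n.+1) => [|k IH] y.
        by rewrite !inE mulr0n subr0.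
      move=> /addfP[b bA [c cA' ->]].
      rewrite mulrS opprD addrACA; apply: mem_addf; last exact: IH.
      by apply: mem_addf => //; rewrite mem_oppf opprK.
    by move=> y z _ _ /addIr.
  have := growth_of_small_spectrum pr_p A0 (ltW rho0) hg spec.
  rewrite mulrDr mulrA.
  have h1 : g%:R * rho ^+ n * p%:R <= 1 / 2 * p%:R by rewrite ler_wpM2r // ltW.
  have h2 : g%:R * #|` A|%:R <= g%:R * (1 / (2 * g + 1)%:R * p%:R) :> R.
    by rewrite ler_wpM2l.
  have h3 : g%:R * (1 / (2 * g + 1)%:R * p%:R) < 1 / 2 * p%:R :> R.
    rewrite mulrA ltr_pM2r // mul1r ltr_pdivrMr ?ltr0n ?addn1 //.
    have -> : (2 * g).+1%:R = 2 * g%:R + 1 :> R by rewrite -[LHS]natr1 natrM.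
    lra.
  lra.
have [b bA hb] := concentration pr_p N1 A0 hr.
set Y := [fset a in A | _] in hb.
have sYA : Y `<=` A by apply/fsubsetP => a; rewrite !inE => /andP[].
have A_gt0 : (0 < #|` A|)%N by rewrite cardfs_gt0.
have Y0 : Y != fset0.
  rewrite -cardfs_gt0 lt0n; apply: contraTneq hb => ->.
  by rewrite muln0 -ltnNge.
have oY0 : oppf Y != fset0 by rewrite -cardfs_gt0 card_oppf cardfs_gt0.
have [S [sSA cS cov]] := ruzsa_covering A oY0.
(* Y contains at least half of A, so |S| |Y| <= |A - Y| <= K |A| <= 2 K |Y|. *)
have {}cS : (#|` S| <= 2 * K)%N.
  have h1 : (#|` addf A (oppf Y)| <= #|` addf A (oppf A)|)%N.
    apply/fsubset_leq_card/addfS => //; apply/fsubsetP => y.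
    by rewrite !mem_oppf => /(fsubsetP sYA).
  have Y_gt0 : (0 < #|` Y|)%N by rewrite cardfs_gt0.
  rewrite -(leq_pmul2r Y_gt0); rewrite card_oppf in cS.
  apply: (leq_trans cS); apply: (leq_trans h1); apply: (leq_trans dK).
  have -> : (2 * K * #|` Y| = K * (2 * #|` Y|))%N by ring.
  by rewrite leq_mul2l hb orbT.
have [tau [/andP[tau0 tauQ] hS]] := dirichlet pr_p S r Q0.
have tauQ' : (tau <= Q ^ (2 * K))%N.
  by apply: (leq_trans tauQ); rewrite leq_pexp2l.
exists (tau%:R * r).
  rewrite mulf_neq0 // -[tau%:R]/(tau%:Z%:~R) Fp_intr_eq0 // dvdzE /=.
  by rewrite gtnNdvd // (leq_ltn_trans tauQ').
move=> a /(fsubsetP cov) /addfP[s sS [_ /addfP[y + [y' + ->]] ->]].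
rewrite oppfK mem_oppf !inE /= => /andP[_ hy] /andP[_ hy'].
have small_y := near_smallF pr_p hy; have small_y' := near_smallF pr_p hy'.
(* Here a = s + y + y' with -y and y' in Y, and r (y + y') is the difference of the two short
   elements r (b + y) and r (b - y'). *)
have := smallFD (hS s sS) (smallFM tau (smallFD small_y (smallFN small_y'))).
have -> : tau%:R * (r * s) + tau%:R * (r * (b - - y) + - (r * (b - y')))
   = tau%:R * r * (s + (y + y')) by ring.
case=> z zb ->; exists z => //.
apply: (@leq_trans ((p %/ Q + tau * (p %/ N + p %/ N)) * Q)).
  by rewrite leq_mul2r zb orbT.
have h1 : (p %/ Q * Q <= p)%N by apply: leq_trunc_div.
have h2 : (tau * (p %/ N + p %/ N) * Q <= p)%N.
  apply: (@leq_trans (Q ^ (2 * K) * (p %/ N + p %/ N) * Q)).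
    by rewrite !leq_mul2r tauQ' !orbT.
  apply: leq_trans (leq_trunc_div p N); set x := (p %/ N)%N.
  rewrite -[X in (_ <= _ * X)%N]/(2 * Q ^ (2 * K).+1)%N expnS leq_eqVlt.
  by apply/orP; left; apply/eqP; ring.
by rewrite mulnDl mul2n -addnn leq_add.
Qed.

(** * Transfer from the integers to residues modulo a prime *)

(** The factor 5 confines integer sums of dilates to absolute value at most 2p/5; two of them differ
    by less than p, so reduction modulo p is injective on them. *)
Lemma card_sumdil_lift (p : nat) (I : eqType) (r : seq I) (l : I -> int)
    (A : {fset 'F_p}) (t : 'F_p) (L := (\sum_(i <- r) `|l i|)%N) :
  prime p -> uniq r -> (0 < L)%N -> t != 0 ->
  (forall a, a \in A ->
     exists2 z : int, (`|z| * (5 * L) <= 2 * p)%N & t * a = z%:~R) ->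
  exists2 B : {fset int}, #|` B| = #|` A| &
    (#|` sumdil r l (fun=> B)| <= #|` sumdil r l (fun=> A)|)%N.
Proof.
move=> pr_p ur L0 t0 hA.
have /choice[Z ZP] : forall a, exists z : int, a \in A ->
    (`|z| * (5 * L) <= 2 * p)%N /\ t * a = z%:~R.
  move=> a; case: (boolP (a \in A)) => [/hA[z z1 z2]|_]; last by exists 0.
  by exists z.
have ZK a : a \in A -> (Z a)%:~R / t = a.
  by move=> /ZP[_ <-]; rewrite mulrAC mulfV // mul1r.
pose B := [fset Z a | a in A].
have cB : #|` B| = #|` A|.
  rewrite card_in_imfset // => a b aA bA e.
  by rewrite -(ZK a) // -(ZK b) // e.
exists B => //.
have bound x : x \in sumdil r l (fun=> B) -> (`|x| * 5 <= 2 * p)%N.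
  move=> /(sumdilP _ _ _ ur)[z zB ->].
  rewrite -(leq_pmul2r L0).
  apply: (@leq_trans (\sum_(i <- r) `|z i| * `|l i| * (5 * L))%N).
    rewrite -mulnA -big_distrl /= leq_mul2r; apply/orP; right.
    elim: (r) => [|i s IH]; first by rewrite !big_nil.
    rewrite !big_cons mulrzz -abszM.
    by apply: leq_trans (leq_add (leqnn _) IH); move: (z i * l i) (\sum_(j <- s) _); lia.
  have -> : (2 * p * L = \sum_(i <- r) 2 * p * `|l i|)%N by rewrite /L big_distrr.
  rewrite big_seq [leqRHS]big_seq; apply: leq_sum => i ir.
  rewrite mulnAC leq_mul2r; apply/orP; right.
  by have /imfsetP[a /= aA ->] := zB i ir; have [] := ZP a aA.
apply: (leq_cardf_inj (f := fun x : int => x%:~R / t)).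
  move=> x /(sumdilP _ _ _ ur)[z zB ->]; apply/(sumdilP _ _ _ ur).
  exists (fun i => (z i)%:~R / t).
    by move=> i /zB /imfsetP[a /= aA ->]; rewrite ZK.
  rewrite rmorph_sum mulr_suml /=; apply: eq_bigr => i _.
  by rewrite mulrzz intrM -[RHS]mulrzr mulrAC.
move=> x y xS yS /(mulIf (invr_neq0 t0)) /eqP.
rewrite -subr_eq0 -intrB Fp_intr_eq0 // => /dvdzP[e he].
have bx := bound _ xS; have bY := bound _ yS.
have p0 := prime_gt0 pr_p.
have : (`|x - y| < p)%N by lia.
rewrite he abszM /= => h.
have e0 : e = 0 by move: h p0; clear; case: e => [[|e]|e] //=; nia.
by apply/eqP; rewrite -subr_eq0 he e0 mul0r.
Qed.

(** [alpha] and [p0] are fixed before E: only the constant C may depend on the precision. *)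
Lemma card_sumdil_Fp_asymptotic (R : realType) (I : eqType) (r : seq I)
    (l : I -> int) (L := (\sum_(i <- r) `|l i|)%N) :
  uniq r -> {in r, forall i, l i != 0} -> \big[gcdz/0]_(i <- r) l i = 1 ->
  exists2 alpha : R, 0 < alpha & exists p0 : nat,
  forall E : nat, (0 < E)%N -> exists C : nat,
  forall p, prime p -> (p0 <= p)%N ->
  forall A : {fset 'F_p}, #|` A|%:R <= alpha * p%:R ->
  (E * (L * #|` A|) <= E * #|` sumdil r l (fun=> A)| + L * #|` A| + C)%N.
Proof.
move=> ur l0 g1; have [sr|sr] := leqP (size r) 1.
  (* A single coefficient must be 1 or -1 and is treated apart, since bounding the difference set
     takes two dilates. *)
  exists 1 => //; exists 0%N => E _; exists 0%N => p _ _ A _.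
  case: r @L ur l0 g1 sr => [|i [|//]] L ur l0 g1 _.
    by move: g1; rewrite big_nil.
  have l1 : `|l i|%N = 1%N by move: g1; rewrite big_cons big_nil gcdz0 => -[].
  have -> : L = 1%N by rewrite /L big_cons big_nil l1.
  rewrite sumdil_cons /sumdil big_nil addfC add0f card_dilf_inj.
    by rewrite !mul1n -addnA leq_addr.
  have : (l i == 1) || (l i == -1) by lia.
  by case/orP => /eqP -> x y /=; rewrite ?mulrN1z //; apply: oppr_inj.
have L0 : (0 < L)%N.
  case: r @L l0 sr {ur g1} => [//|i r] L l0 _.
  by rewrite /L big_cons addn_gt0 absz_gt0 l0 // mem_head.
have Q0 : (0 < 5 * L)%N by rewrite muln_gt0.
have [alpha alpha0 rect] := rectification R (L ^ 2) Q0.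
(* Beyond this bound p exceeds the Dirichlet multipliers, and also L, so that every coefficient is
   invertible modulo p. *)
exists alpha => //; exists ((5 * L) ^ (2 * L ^ 2) + L).+1 => E E0.
have [C CP] := card_sumdil_int_asymptotic ur sr l0 g1 E0.
exists C => p pr_p pp A cA.
have [->|A0] := eqVneq A fset0; first by rewrite cardfs0 !muln0.
have [small|big] := leqP #|` sumdil r l (fun=> A)| (L * #|` A|); last first.
  apply: (@leq_trans (E * #|` sumdil r l (fun=> A)|)).
    by rewrite leq_mul2l ltnW ?orbT.
  by rewrite -addnA leq_addr.
have linj : {in r, forall i, injective (fun x : 'F_p => x *~ l i)}.
  move=> i ir x y /= e.
  have lp : (l i)%:~R != 0 :> 'F_p.
    rewrite Fp_intr_eq0 // dvdzE /= gtnNdvd ?absz_gt0 ?l0 //.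
    have lL : (`|l i| <= L)%N by rewrite /L (big_rem i ir) /= leq_addr.
    by apply: leq_trans pp; rewrite ltnS (leq_trans lL) // leq_addl.
  by apply: (mulIf lp); rewrite !mulrzr.
have dK := small_difference_set sr A0 linj small.
have pQ : ((5 * L) ^ (2 * L ^ 2) < p)%N by apply: leq_trans pp; rewrite ltnS leq_addr.
have [t t0 tA] := rect p pr_p pQ A A0 dK cA.
have [B cB sB] := card_sumdil_lift pr_p ur L0 t0 tA.
have := CP B; rewrite cB => h; apply: (leq_trans h).
by rewrite !leq_add2r leq_mul2l sB orbT.
Qed.

Lemma sumdil_sub_sum_dilates (p k : nat) (lambda : 'I_k -> int) (A : {set 'F_p}) :
  A != finset.set0 ->
  (#|` sumdil [seq i <- index_enum 'I_k | lambda i != 0] lambda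
        (fun=> [fset x in A])| <= #|sum_dilates lambda A|)%N.
Proof.
move=> A0; rewrite cardE; apply: uniq_leq_size; first exact: fset_uniq.
move=> y; rewrite mem_enum /sum_dilates.
elim: (index_enum 'I_k) y => [|i s IH] y /=.
  by rewrite /sumdil !big_nil !inE.
rewrite big_cons; case: ifP => [li|/negbFE/eqP li].
  rewrite sumdil_cons => /addfP[_ /dilfP[a aA ->] [z zs ->]].
  apply/imset2P; exists (a *~ lambda i) z => //; last exact: IH.
  by apply/finset.imsetP; exists a => //; move: aA; rewrite !inE.
move=> ys; apply/imset2P; exists 0 y; rewrite ?add0r //; last exact: IH.
have /set0Pn[a aA] := A0; apply/finset.imsetP; exists a => //.
by rewrite li mulr0z.
Qed.

Theorem theorem3 (R : realType) (k : nat) (lambda : 'I_k -> int) :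
  \big[gcdz/0]_(i < k) lambda i = 1 ->
  exists (alpha : R) (g : nat -> R),
    [/\ 0 < alpha,
        forall n : nat, 0 <= g n,
        (g n / n%:R @[n --> \oo] --> (0 : R))%classic
      & exists p0 : nat, forall p : nat, prime p -> (p0 <= p)%N ->
          forall A : {set 'F_p}, #|A|%:R <= alpha * p%:R ->
            (\sum_(i < k) `|lambda i|)%:~R * #|A|%:R - g #|A|
              <= #|sum_dilates lambda A|%:R].
Proof.
move=> g1.
pose r := [seq i <- index_enum 'I_k | lambda i != 0].
have ur : uniq r by rewrite filter_uniq // index_enum_uniq.
have l0 : {in r, forall i, lambda i != 0} by move=> i; rewrite mem_filter => /andP[].
have gr : \big[gcdz/0]_(i <- r) lambda i = 1.
  rewrite -g1 /r; elim: (index_enum 'I_k) => [|i s IH] /=; first by rewrite !big_nil.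
  rewrite big_cons; case: ifP => [_|/negbFE/eqP ->]; first by rewrite big_cons IH.
  rewrite IH gcd0z; case: (s) => [|j s']; first by rewrite big_nil.
  by rewrite big_cons /gcdz absz_nat.
have [alpha alpha0 [p0 Hp]] := card_sumdil_Fp_asymptotic R ur l0 gr.
set L := (\sum_(i <- r) _)%N in Hp.
have LE : (\sum_(i < k) `|lambda i|)%:~R = L%:R :> R.
  rewrite (pmulrn 1 L); congr (_%:~R).
  rewrite /L /r big_filter (big_morph _ PoszD (erefl 0%:Z)) [RHS]big_mkcond /=.
  by apply: eq_bigr => i _; case: eqP => [->|_]; rewrite ?normr0 // abszE.
have /choice[C CP] : forall j : nat, exists C : nat, forall p, prime p -> (p0 <= p)%N ->
    forall A : {fset 'F_p}, #|` A|%:R <= alpha * p%:R ->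
    (j.+1 * (L * #|` A|) <= j.+1 * #|` sumdil r lambda (fun=> A)| + L * #|` A| + C)%N.
  by move=> j; apply: Hp.
(* [h j] is the error for E = j + 1. Minimising over j <= n keeps the range finite and yields g n <=
   h j n once n >= j, so g n / n is eventually at most L / (j + 1) plus any positive margin. *)
pose h (j n : nat) : R := (L * n + C j)%:R / j.+1%:R.
pose J (n : nat) : 'I_n.+1 := [arg min_(j < ord0 : 'I_n.+1) h j n]%O.
pose g n := h (J n) n.
have gh j n : (j <= n)%N -> g n <= h j n.
  rewrite -ltnS => jn; rewrite /g /J.
  by case: arg_minP => // i _ /(_ (Ordinal jn) isT).
exists alpha, g; split => //.
- by move=> n; rewrite /g /h divr_ge0.
- apply/cvgrPdist_lt => e e0.
  (* j makes L / (j + 1) smaller than e / 2; with j fixed, n0 does the same for C j / n. *)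
  pose j := Num.Def.archi_bound (L%:R / (e / 2)).
  have jP : L%:R / j.+1%:R < e / 2.
    rewrite ltr_pdivrMr ?ltr0n // mulrC -ltr_pdivrMr ?divr_gt0 //.
    apply: (lt_trans (archi_boundP _)); first by rewrite !divr_ge0 // ltW.
    by rewrite ltr_nat.
  pose n0 := Num.Def.archi_bound ((C j)%:R / (e / 2)).
  exists (maxn j n0).+1 => // n /= nn0.
  have n_gt0 : (0 < n)%N by apply: leq_trans nn0.
  have nj : (j <= n)%N by apply: leq_trans (ltnW nn0); rewrite leq_maxl.
  have nn : (n0 <= n)%N by apply: leq_trans (ltnW nn0); rewrite leq_maxr.
  have n0R : (0 : R) < n%:R by rewrite ltr0n.
  have CjP : (C j)%:R / n%:R < e / 2.
    rewrite ltr_pdivrMr // mulrC -ltr_pdivrMr ?divr_gt0 //.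
    apply: (lt_le_trans (archi_boundP _)); first by rewrite !divr_ge0 // ltW.
    by rewrite ler_nat.
  rewrite sub0r normrN ger0_norm; last by rewrite divr_ge0 // /g /h divr_ge0.
  apply: (@le_lt_trans _ _ (h j n / n%:R)); first by rewrite ler_pM2r ?invr_gt0 // gh.
  have -> : h j n / n%:R = L%:R / j.+1%:R + (C j)%:R / n%:R / j.+1%:R.
    rewrite /h natrD natrM !(mulrAC _ j.+1%:R^-1) !mulrDl mulfK ?gt_eqF //.
  rewrite [ltRHS](splitr e); apply: ltr_leD => //; apply: le_trans (ltW CjP).
  by rewrite ler_pdivrMr ?ltr0n // ler_peMr ?divr_ge0 // ler1n.
- exists p0 => p pr_p pp A cA; rewrite LE.
  have [->|A0] := eqVneq A finset.set0.
    rewrite cards0 mulr0 sub0r; apply: (@le_trans _ _ 0) => //.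
    by rewrite oppr_le0 /g /h divr_ge0.
  have cf : #|` [fset x in A]| = #|A| by rewrite card_finset.
  have := CP (J #|A|) p pr_p pp [fset x in A]; rewrite cf => /(_ cA) H.
  have S := sumdil_sub_sum_dilates lambda A0.
  rewrite lerBlDr; apply: (@le_trans _ _
     (#|` sumdil r lambda (fun=> [fset x in A])|%:R + g #|A|)); last first.
    by rewrite lerD2r ler_nat.
  move: H; set s := #|` sumdil _ _ _|; rewrite -(ler_nat R) !natrD !natrM => H.
  have J0 : (0 : R) < (J #|A|).+1%:R by rewrite ltr0n.
  rewrite -(ler_pM2l J0) mulrDr /g /h [X in _ <= _ + X]mulrCA mulfV ?gt_eqF // mulr1.
  rewrite natrD natrM -[(J #|A|).+1%:R]natr1; lra.
Qed.
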